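(* Let $T$ be a completely non-coisometric commuting contractive $n$-tuple on a complex Hilbert space $\mathcal{H}$, let $\Delta=(I_{H^2_n\otimes\mathcal{D}_T}-M_{\theta_T}^*M_{\theta_T})^{1/2}$, and let $$\mathbb{H}_T=\big((H^2_n\otimes\mathcal{D}_{T^*})\oplus\overline{\mathrm{Ran}}\,\Delta\big)\ominus\{(M_{\theta_T}u,\Delta u):u\in H^2_n\otimes\mathcal{D}_T\}.$$ Then $T$ is unitarily equivalent to the tuple $\mathbb{T}=(\mathbb{T}_1,\dots,\mathbb{T}_n)\in\mathcal{B}(\mathbb{H}_T)^n$ whose action is given by $$\mathbb{T}_i^*(u,v)=\big((M_{z_i}^*\otimes I_{\mathcal{D}_{T^*}})u,\ \Delta^{-1}(M_{z_i}^*\otimes I_{\mathcal{D}_T})\Delta v\big)$$ for $(u,v)\in\mathbb{H}_T$ and $i=1,\dots,n$.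
   Context: $\mathbb{B}_n$ is the open Euclidean unit ball of $\mathbb{C}^n$. A commuting contractive $n$-tuple $T=(T_1,\dots,T_n)$ on $\mathcal{H}$ is a tuple of commuting bounded operators with $\sum_{i=1}^n T_iT_i^*\le 1_{\mathcal{H}}$. The letter $T$ also denotes the row contraction $\mathcal{H}^n\to\mathcal{H}$, $(h_1,\dots,h_n)\mapsto\sum_iT_ih_i$, with adjoint $T^*:h\mapsto(T_1^*h,\dots,T_n^*h)$. Put $D_{T^*}=(1_{\mathcal{H}}-TT^* )^{1/2}$, $\mathcal{D}_{T^*}=\overline{\mathrm{Ran}}\,D_{T^*}$, $D_T=(1_{\mathcal{H}^n}-T^*T)^{1/2}$, $\mathcal{D}_T=\overline{\mathrm{Ran}}\,D_T\subset\mathcal{H}^n$. $T$ is a co-isometry if $T^*:\mathcal{H}\to\mathcal{H}^n$ is an isometry. A commuting contractive tuple $T$ is completely non-coisometric (c.n.c.) if there is no non-trivial (i.e. nonzero) closed joint invariant subspace $\mathcal{M}$ of $T_1^*,\dots,T_n^*$ such that $P_{\mathcal{M}}T|_{\mathcal{M}}=(P_{\mathcal{M}}T_1|_{\mathcal{M}},\dots,P_{\mathcal{M}}T_n|_{\mathcal{M}})$ is a co-isometry. For a Hilbert space $\mathcal{E}$, $H^2_n(\mathcal{E})$ is the Hilbert space of analytic $f=\sum_{k\in\mathbb{N}^n}a_kz^k:\mathbb{B}_n\to\mathcal{E}$ with $\|f\|^2=\sum_k\|a_k\|^2/\gamma_k<\infty$, $\gamma_k=|k|!/k!$; $H^2_n=H^2_n(\mathbb{C})$,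 and $H^2_n(\mathcal{E})$ is identified with $H^2_n\otimes\mathcal{E}$. $M_z=(M_{z_1},\dots,M_{z_n})$ is the tuple of multiplications by the coordinate functions on $H^2_n$. The characteristic function is $\theta_T(z)=-T+D_{T^*}(1_{\mathcal{H}}-ZT^* )^{-1}ZD_T$ (restricted to $\mathcal{D}_T$, values in $\mathcal{B}(\mathcal{D}_T,\mathcal{D}_{T^*})$), $z\in\mathbb{B}_n$, with row operator $Z=(z_1I_{\mathcal{H}},\dots,z_nI_{\mathcal{H}})$. The multiplication operator $M_{\theta_T}:H^2_n\otimes\mathcal{D}_T\to H^2_n\otimes\mathcal{D}_{T^*}$, $f\mapsto\theta_Tf$, is a well-defined contraction. $\Delta^{-1}:\mathrm{Ran}\,\Delta\to(\mathrm{Ker}\,\Delta)^\perp=\overline{\mathrm{Ran}}\,\Delta$ denotes the inverse of the bijective linear map $\Delta:(\mathrm{Ker}\,\Delta)^\perp\to\mathrm{Ran}\,\Delta$. Tuples $T$ on $\mathcal{H}$ and $R$ on $\mathcal{K}$ are unitarily equivalent if there is a unitary $U:\mathcal{K}\to\mathcal{H}$ with $T_i=UR_iU^*$ for all $i$. *)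

(* Defs.v *)
From HB Require Import structures.
From mathcomp Require Import all_boot all_order all_algebra.
From mathcomp Require Import finmap complex.
From mathcomp Require Import boolp classical_sets functions filter reals.
From mathcomp Require Import topology normedtype.
From mathcomp Require Import summability ring.

Set Implicit Arguments.
Unset Strict Implicit.
Unset Printing Implicit Defensive.

Import Order.TTheory GRing.Theory Num.Def Num.Theory.
Import numFieldNormedType.Exports.

Local Open Scope classical_set_scope.
Local Open Scope ring_scope.

Section DotNorm.
Variables (C : numClosedFieldType) (V : lmodType C) (d : {dot V for conjC}).

Let norm x := sqrtC (d x x).

Lemma dot_CauchySchwarz x y : `|d x y| <= norm x * norm y.
Proof.
rewrite -(@ler_pXn2r _ 2) ?nnegrE ?mulr_ge0 ?sqrt_dnorm_ge0 //.
rewrite exprMn !sqrtCK.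
have [->|y0] := eqVneq y 0; first by rewrite !linear0r normr0 expr0n mulr0.
have yy0 : 0 < d y y by rewrite dnorm_gt0.
have := dnorm_ge0 d (d y y *: x - d x y *: y).
rewrite dnormB !dnormZ linearZl_LR linearZr_LR /= (ger0_norm (ltW yy0)).
have -> : d y y * ((d x y)^* * d x y) = d y y * `|d x y| ^+ 2.
  by rewrite -normCKC.
have re : d y y * `|d x y| ^+ 2 \is Num.real.
  by rewrite rpredM ?rpredX ?normr_real ?ger0_real ?(ltW yy0).
rewrite (CrealP re) (mulrC (`|d x y| ^+ 2)) opprD addrA addrK => h.
by rewrite -(ler_pM2l yy0) -subr_ge0 [d x x * _]mulrC mulrA -expr2.
Qed.

Lemma dot_ler_normD x y : norm (x + y) <= norm x + norm y.
Proof.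
rewrite -(@ler_pXn2r _ 2) ?nnegrE ?addr_ge0 ?sqrt_dnorm_ge0 //.
rewrite sqrrD !sqrtCK dnormD [leRHS]addrAC lerD2l.
have re : d x y + (d x y)^* \is Num.real.
  by rewrite CrealE rmorphD /= conjCK addrC.
rewrite (le_trans (real_ler_norm re)) // (le_trans (ler_normD _ _)) //.
by rewrite norm_conjC -mulr2n lerMn2r dot_CauchySchwarz orbT.
Qed.

End DotNorm.
(* The forms {dot V for conjC} are linear in the first argument and
   conjugate-linear in the second one. *)
HB.mixin Record isInnerProduct (R : realType) V & NormedModule R[i] V := {
  hdot : {dot V for conjC};
  hdotxx : forall x, hdot x x = `|x| ^+ 2
}.

#[short(type="preHilbertType")]
HB.structure Definition PreHilbert (R : realType) :=
  {V of NormedModule R[i] V & isInnerProduct R V}.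

#[short(type="hilbertType")]
HB.structure Definition Hilbert (R : realType) :=
  {V of PreHilbert R V & Complete V}.

Notation "''[' u , v ]" := (hdot u%R v%R) : ring_scope.
Notation "''[' u ]" := '[u, u] : ring_scope.

HB.factory Record Lmodule_isPreHilbert (R : realType) V & GRing.Lmodule R[i] V := {
  dotp : V -> V -> R[i];
  dotpPl : forall z, scalar (dotp^~ z);
  dotpC : forall x y, dotp y x = (dotp x y)^*;
  dotp_gt0 : forall x, x != 0 -> 0 < dotp x x
}.

HB.builders Context R V & Lmodule_isPreHilbert R V.

Let dotpDl z : {morph dotp^~ z : x y / x - y}.
Proof. by move=> x y; rewrite -scaleN1r addrC dotpPl mulN1r addrC. Qed.

Let dotpZl z : scalable_for *%R (dotp^~ z).
Proof.
move=> a x; have := dotpPl z a x 0.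
have := dotpDl z 0 0; rewrite subrr => ->.
by rewrite !subrr !addr0.
Qed.

Let dotpDr z : {morph dotp z : x y / x - y}.
Proof. by move=> x y; rewrite dotpC dotpDl rmorphB /= -!dotpC. Qed.

Let dotpZr z : scalable_for (conjC \; *%R) (dotp z).
Proof. by move=> a x; rewrite dotpC dotpZl rmorphM /= -dotpC. Qed.

HB.instance Definition _ := @isBilinear.Build R[i] V V R[i] *%R (conjC \; *%R)
  dotp dotpDl dotpDr dotpZl dotpZr.

Let dotp_herm x y : dotp x y = (-1) ^+ false * conjC (dotp y x).
Proof. by rewrite mul1r -dotpC. Qed.

HB.instance Definition _ := @isHermitianSesquilinear.Build R[i] V false conjC
  dotp dotp_herm.

HB.instance Definition _ := @isDotProduct.Build R[i] V dotp dotp_gt0.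

Let d : {dot V for conjC} := dotp.

Let norm x := sqrtC (d x x).

Let ler_normD x y : norm (x + y) <= norm x + norm y.
Proof. exact: (dot_ler_normD d). Qed.

Let normrZ l x : norm (l *: x) = `|l| * norm x.
Proof. by rewrite /norm dnormZ sqrtCM ?nnegrE ?exprn_ge0 ?dnorm_ge0 // sqrCK. Qed.

Let normr0_eq0 x : norm x = 0 -> x = 0.
Proof. by move/eqP; rewrite sqrt_dnorm_eq0 => /eqP. Qed.

HB.instance Definition _ :=
  Lmodule_isNormed.Build R[i] V ler_normD normrZ normr0_eq0.

Let dxx x : d x x = `|x| ^+ 2.
Proof. by rewrite -[RHS]/(norm x ^+ 2) sqrtCK. Qed.

HB.instance Definition _ := isInnerProduct.Build R V dxx.

HB.end.

Section InnerProductTheory.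
Variables (R : realType) (V : preHilbertType R).
Implicit Types x y : V.

Lemma hnormE x : `|x| = sqrtC '[x].
Proof. by rewrite hdotxx sqrCK. Qed.

Lemma hdotPl (z : V) a x y : '[a *: x + y, z] = a * '[x, z] + '[y, z].
Proof. by rewrite linearDl linearZl_LR. Qed.

Lemma hdotC x y : '[y, x] = '[x, y]^*.
Proof. by rewrite (hermC _ y x) expr0 mul1r. Qed.

End InnerProductTheory.

Section ComplexLimits.
Variables (R : realType) (T : Type) (F : set_system T).
Context {FF : ProperFilter F}.

Lemma cvg_ge0C (u : T -> R[i]^o) (l : R[i]) :
  u t @[t --> F] --> (l : R[i]^o) -> (\forall t \near F, 0 <= u t) -> 0 <= l.
Proof.
move=> ul u0; rewrite ger0_def; apply/eqP.
have ul' : (`|u t| : R[i]^o) @[t --> F] --> (`|l| : R[i]^o) by exact: (cvg_norm ul).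
have ul2 : u t @[t --> F] --> (`|l| : R[i]^o).
  apply: cvg_trans ul'; apply: near_eq_cvg.
  by apply: filterS u0 => t ut; rewrite ger0_norm.
exact: (cvg_unique (@norm_hausdorff _ R[i]^o) ul2 ul).
Qed.

Lemma cvg_leC (u : T -> R[i]^o) (l M : R[i]) :
  u t @[t --> F] --> (l : R[i]^o) -> (\forall t \near F, u t <= M) -> l <= M.
Proof.
move=> ul uM; rewrite -subr_ge0.
apply: (@cvg_ge0C (fun t => (M : R[i]^o) - u t)).
  exact: (cvgB (cvg_cst (M : R[i]^o)) ul).
by apply: filterS uM => t; rewrite subr_ge0.
Qed.

End ComplexLimits.

Lemma cvg_approx (R : realType) (V : preHilbertType R) (F : set_system V) (l : V) :
  ProperFilter F ->
  (forall e, 0 < e -> exists2 x, `|l - x| <= e & F (ball x e)) -> F --> l.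
Proof.
move=> FF h; apply/cvgrPdist_le => e e0.
have [x lx Fx] := h (e / 2) (divr_gt0 e0 (ltr0Sn _ 1)).
apply: filterS Fx => y; rewrite -ball_normE /= => xy.
rewrite (le_trans (ler_distD x _ _)) // (splitr e) lerD //; exact: ltW.
Qed.

Record clsubspace (R : realType) (H : hilbertType R) := ClSubspace {
  cls_set : set H;
  cls0 : cls_set 0;
  clsP : forall (a : R[i]) (x y : H), cls_set x -> cls_set y -> cls_set (a *: x + y);
  cls_closed : closed cls_set
}.

Definition cls_pred (R : realType) (H : hilbertType R) (M : clsubspace H) : {pred H} :=
  fun x => `[< cls_set M x >].

Section SubspaceType.
Variables (R : realType) (H : hilbertType R) (M : clsubspace H).

Let cls_pred_submod : submod_closed (cls_pred M).
Proof.
split; first by apply/asboolP; exact: cls0.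
by move=> a x y /asboolP Mx /asboolP My; apply/asboolP; exact: clsP.
Qed.

HB.instance Definition _ := GRing.isSubmodClosed.Build R[i] H (cls_pred M) cls_pred_submod.

Record cls_type := ClsElt { cls_val : H; _ : cls_val \in cls_pred M }.

HB.instance Definition _ := [isSub for cls_val].
HB.instance Definition _ := [Choice of cls_type by <:].
HB.instance Definition _ := [SubChoice_isSubLmodule of cls_type by <:].

Let sdot (x y : cls_type) : R[i] := '[val x, val y].

Let sdotPl z : scalar (sdot^~ z).
Proof. by move=> a x y; rewrite /sdot linearP hdotPl. Qed.

Let sdotC x y : sdot y x = (sdot x y)^*.
Proof. exact: hdotC. Qed.

Let sdot_gt0 x : x != 0 -> 0 < sdot x x.
Proof. by move=> x0; rewrite /sdot dnorm_gt0 -[0](raddf0 (val : cls_type -> H)) (inj_eq val_inj). Qed.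

HB.instance Definition _ :=
  Lmodule_isPreHilbert.Build R cls_type sdotPl sdotC sdot_gt0.

Lemma cls_normE (x : cls_type) : `|x| = `|val x|.
Proof. by rewrite !hnormE. Qed.

Lemma cls_valP (x : cls_type) : cls_set M (val x).
Proof. exact/asboolP/(valP x). Qed.

Let cls_complete (F : set_system cls_type) : ProperFilter F -> cauchy F -> cvg F.
Proof.
move=> FF cF.
have cvF : cauchy (val @ F).
  apply/cauchyP => e e0.
  have /cauchyP/(_ e e0)[x Fx] := cF.
  exists (val x); change (F (val @^-1` ball (val x) e)).
  apply: filterS Fx => y; rewrite /preimage /mkset -!ball_normE /=.
  by rewrite cls_normE raddfB.
have /cauchy_cvg vl := cvF.
set l := lim (val @ F) in vl.
have Ml : cls_set M l.
  by apply: closed_cvg vl; [exact: cls_closed|apply: nearW => x; exact: cls_valP].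
have Ml' : l \in cls_pred M by apply/asboolP.
apply/cvg_ex; exists (ClsElt Ml').
apply/cvgrPdist_le => e e0.
move/cvgrPdist_le: vl => /(_ e e0).
by apply: filterS => x; rewrite cls_normE raddfB.
Qed.

HB.instance Definition _ := Uniform_isComplete.Build cls_type cls_complete.

End SubspaceType.

Coercion cls_type : clsubspace >-> Sortclass.

Lemma cvg_sqrnorm (R : realType) (V : normedModType R[i]) (T : Type)
    (F : set_system T) (FF : ProperFilter F) (u : T -> V) (l x : V) :
  u t @[t --> F] --> l ->
  (`|u t - x| ^+ 2 : R[i]^o) @[t --> F] --> (`|l - x| ^+ 2 : R[i]^o).
Proof.
move=> ul.
have h : (`|u t - x| : R[i]^o) @[t --> F] --> (`|l - x| : R[i]^o).
  exact: (cvg_norm (cvgB ul (cvg_cst x))).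
rewrite expr2 (_ : (fun t => _) = (fun t => `|u t - x| * `|u t - x| : R[i]^o)).
  exact: (cvgM h h).
by apply/funext => t; rewrite expr2.
Qed.

Lemma cvg_sumC (R : realType) (T : Type) (F : set_system T) (FF : ProperFilter F)
    (I : Type) (r : seq I) (u : I -> T -> R[i]^o) (l : I -> R[i]^o) :
  (forall i, u i t @[t --> F] --> l i) ->
  (\sum_(i <- r) u i t : R[i]^o) @[t --> F] --> (\sum_(i <- r) l i : R[i]^o).
Proof.
move=> h; elim: r => [|i r IH].
  rewrite big_nil (_ : (fun t => _) = (fun=> 0 : R[i]^o)); first exact: cvg_cst.
  by apply/funext => t; rewrite big_nil.
rewrite big_cons (_ : (fun t => _) = (fun t => u i t + \sum_(j <- r) u j t : R[i]^o)).
  exact: (cvgD (h i) IH).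
by apply/funext => t; rewrite big_cons.
Qed.

(* hpow and hsum are aliases: they carry the Hilbert norm, whereas the library
   puts the sup norm on product types. *)
Definition hpow (R : realType) (n : nat) (H : hilbertType R) := {ffun 'I_n -> H}.

Section HilbertPower.
Variables (R : realType) (n : nat) (H : hilbertType R).
Local Notation Hn := (hpow n H).

HB.instance Definition _ := GRing.Lmodule.on Hn.

Let pdot (x y : Hn) : R[i] := \sum_i '[x i, y i].

Let pdotPl z : scalar (pdot^~ z).
Proof.
move=> a x y; rewrite /pdot mulr_sumr -big_split; apply: eq_bigr => i _ /=.
by rewrite !ffunE hdotPl.
Qed.

Let pdotC x y : pdot y x = (pdot x y)^*.
Proof. by rewrite rmorph_sum; apply: eq_bigr => i _ /=; exact: hdotC. Qed.

Let pdot_gt0 x : x != 0 -> 0 < pdot x x.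
Proof.
move=> x0; rewrite lt_neqAle sumr_ge0 ?andbT => [|i _]; last exact: dnorm_ge0.
apply: contra x0; rewrite eq_sym psumr_eq0 => [/allP h|i _]; last exact: dnorm_ge0.
apply/eqP/ffunP => i; rewrite ffunE; apply/eqP; rewrite -(dnorm_eq0 hdot).
by have := h i (mem_index_enum _); rewrite implyTb.
Qed.

HB.instance Definition _ := Lmodule_isPreHilbert.Build R Hn pdotPl pdotC pdot_gt0.

Let hpow_normE (x : Hn) : `|x| ^+ 2 = \sum_i `|x i| ^+ 2.
Proof. by rewrite -hdotxx; apply: eq_bigr => i _; rewrite hdotxx. Qed.

Lemma hpow_le_coord (x : Hn) i : `|x i| <= `|x|.
Proof.
rewrite -(@ler_pXn2r _ 2) ?nnegrE // hpow_normE (bigD1 i) //= lerDl.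
by apply: sumr_ge0 => j _; rewrite exprn_ge0.
Qed.

Let hpow_complete (F : set_system Hn) : ProperFilter F -> cauchy F -> cvg F.
Proof.
move=> FF cF.
have cvi i : exists l : H, (fun x : Hn => x i) @ F --> l.
  apply/cvg_ex; apply: cauchy_cvg; apply/cauchyP => e e0.
  have /cauchyP/(_ e e0)[x Fx] := cF.
  exists (x i); change (F ((fun x : Hn => x i) @^-1` ball (x i) e)).
  apply: filterS Fx => y; rewrite /preimage /mkset -!ball_normE /=.
  by have := hpow_le_coord (x - y) i; rewrite !ffunE => /le_lt_trans; apply.
have [l Fl] := choice cvi.
apply/cvg_ex; exists (finfun l); apply: cvg_approx => e e0.
have /cauchyP/(_ e e0)[x Fx] := cF.
exists x => //; rewrite -(@ler_pXn2r _ 2) ?nnegrE ?(ltW e0) // hpow_normE.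
have lim : (\sum_i `|(y - x) i| ^+ 2 : R[i]^o) @[y --> F] -->
           (\sum_i `|(finfun l - x) i| ^+ 2 : R[i]^o).
  apply: cvg_sumC => i.
  rewrite (_ : (fun y : Hn => _) = (fun y : Hn => `|y i - x i| ^+ 2)).
    by rewrite !ffunE; exact: (@cvg_sqrnorm _ _ _ _ FF _ _ (x i) (Fl i)).
  by apply/funext => y; rewrite !ffunE.
apply: (cvg_leC lim); apply: filterS Fx => y.
rewrite -ball_normE /= => /ltW xy.
by rewrite -hpow_normE distrC lerXn2r ?nnegrE ?(ltW e0).
Qed.

HB.instance Definition _ := Uniform_isComplete.Build Hn hpow_complete.

End HilbertPower.

Definition hsum (R : realType) (H K : hilbertType R) := (H * K)%type.

Section HilbertSum.
Variables (R : realType) (H K : hilbertType R).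
Local Notation HK := (hsum H K).

HB.instance Definition _ := GRing.Lmodule.on HK.

Let sdot (x y : HK) : R[i] := '[x.1, y.1] + '[x.2, y.2].

Let sdotPl z : scalar (sdot^~ z).
Proof. by move=> a x y; rewrite /sdot !hdotPl mulrDr addrACA. Qed.

Let sdotC x y : sdot y x = (sdot x y)^*.
Proof. by rewrite /sdot rmorphD /= -!hdotC. Qed.

Let sdot_gt0 x : x != 0 -> 0 < sdot x x.
Proof.
move=> x0; rewrite lt_neqAle addr_ge0 ?dnorm_ge0 // andbT.
apply: contra x0; rewrite eq_sym paddr_eq0 ?dnorm_ge0 // !dnorm_eq0.
by case: x => x y /= /andP[/eqP-> /eqP->].
Qed.

HB.instance Definition _ := Lmodule_isPreHilbert.Build R HK sdotPl sdotC sdot_gt0.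

Let hsum_normE (x : HK) : `|x| ^+ 2 = `|x.1| ^+ 2 + `|x.2| ^+ 2.
Proof. by rewrite -!hdotxx. Qed.

Let le_fst (x : HK) : `|x.1| <= `|x|.
Proof. by rewrite -(@ler_pXn2r _ 2) ?nnegrE // hsum_normE lerDl exprn_ge0. Qed.

Let le_snd (x : HK) : `|x.2| <= `|x|.
Proof. by rewrite -(@ler_pXn2r _ 2) ?nnegrE // hsum_normE lerDr exprn_ge0. Qed.

Let hsum_complete (F : set_system HK) : ProperFilter F -> cauchy F -> cvg F.
Proof.
move=> FF cF.
have [l1 Fl1] : exists l : H, (fun x : HK => x.1) @ F --> l.
  apply/cvg_ex; apply: cauchy_cvg; apply/cauchyP => e e0.
  have /cauchyP/(_ e e0)[x Fx] := cF.
  exists x.1; change (F ((fun x : HK => x.1) @^-1` ball x.1 e)).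
  apply: filterS Fx => y; rewrite /preimage /mkset -!ball_normE /=.
  by apply: le_lt_trans; exact: (le_fst (x - y)).
have [l2 Fl2] : exists l : K, (fun x : HK => x.2) @ F --> l.
  apply/cvg_ex; apply: cauchy_cvg; apply/cauchyP => e e0.
  have /cauchyP/(_ e e0)[x Fx] := cF.
  exists x.2; change (F ((fun x : HK => x.2) @^-1` ball x.2 e)).
  apply: filterS Fx => y; rewrite /preimage /mkset -!ball_normE /=.
  by apply: le_lt_trans; exact: (le_snd (x - y)).
apply/cvg_ex; exists ((l1, l2) : HK); apply: cvg_approx => e e0.
have /cauchyP/(_ e e0)[x Fx] := cF.
exists x => //; rewrite -(@ler_pXn2r _ 2) ?nnegrE ?(ltW e0) // hsum_normE.
have lim1 := @cvg_sqrnorm _ _ _ _ FF _ _ x.1 Fl1.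
have lim2 := @cvg_sqrnorm _ _ _ _ FF _ _ x.2 Fl2.
apply: (cvg_leC (cvgD lim1 lim2)); apply: filterS Fx => y.
rewrite -ball_normE /= => /ltW xy.
have := hsum_normE (y - x) => /= <-.
by rewrite distrC lerXn2r ?nnegrE ?(ltW e0).
Qed.

HB.instance Definition _ := Uniform_isComplete.Build HK hsum_complete.

End HilbertSum.

#[export] Existing Instance totally_filter.

Lemma cvg_eqfun (T : Type) (V : topologicalType) (F : set_system T) (f g : T -> V) (l : V) :
  f =1 g -> g @ F --> l -> f @ F --> l.
Proof. by move=> /funext ->. Qed.

Section UnconditionalSums.
Variables (R : realType) (I : choiceType).
Implicit Types (u v : I -> R[i]) (A B : {fset I}).

Lemma partial_sumE u A : partial_sum u A = \sum_(i <- A) u i.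
Proof. by rewrite /partial_sum -(big_seq_fsetE _ _ predT). Qed.

Lemma partial_sum_ge0 u A : (forall i, 0 <= u i) -> 0 <= partial_sum u A.
Proof. by move=> u0; rewrite partial_sumE sumr_ge0. Qed.

Lemma le_partial_sum u A B :
  (forall i, 0 <= u i) -> (A `<=` B)%fset -> partial_sum u A <= partial_sum u B.
Proof.
move=> u0 AB; rewrite !partial_sumE [leRHS](bigID (mem A)) /=.
rewrite -[X in _ <= X + _]big_filter.
have -> : \sum_(i <- [seq i <- B | i \in A]) u i = \sum_(i <- A) u i.
  apply: perm_big; apply: uniq_perm => [||i]; rewrite ?filter_uniq ?fset_uniq //.
  by rewrite mem_filter; case: (boolP (i \in A)) => // /(fsubsetP AB) ->.
by rewrite lerDl sumr_ge0.
Qed.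

Lemma partial_sumP u v a A :
  partial_sum (fun i => a * u i + v i) A = a * partial_sum u A + partial_sum v A.
Proof. by rewrite !partial_sumE big_split mulr_sumr. Qed.

Lemma cvg_partial_sum_bounded u M :
  (forall i, 0 <= u i) -> (forall A, partial_sum u A <= M) ->
  exists l : R[i]^o, (partial_sum u : {fset I} -> R[i]^o) @ totally --> l.
Proof.
move=> u0 uM.
have PSr A : partial_sum u A = (complex.Re (partial_sum u A))%:C%C.
  by rewrite RRe_real // ger0_real // partial_sum_ge0.
pose S := [set complex.Re (partial_sum u A) | A in [set: {fset I}]].
have supS : has_sup S.
  split; first by exists (complex.Re (partial_sum u fset0)), fset0.
  exists (complex.Re M) => _ [A _ <-].
  by have := uM A; rewrite lecE => /andP[].
exists ((sup S)%:C%C : R[i]^o); apply/cvgrPdist_le => e e0.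
have er : e = (complex.Re e)%:C%C by rewrite RRe_real // gtr0_real.
have re0 : 0 < complex.Re e by rewrite -ltcR -er.
have [_ [A _ <-] SA] := sup_adherent re0 supS.
exists A => // B /= AB.
rewrite PSr -rmorphB /= ger0_norm.
  rewrite er lecR lerBlDr -lerBlDl.
  apply: le_trans (ltW SA) _.
  by rewrite -lecR -!PSr le_partial_sum.
rewrite ler0c subr_ge0; apply: sup_upper_bound => //.
by exists B.
Qed.

End UnconditionalSums.

Section WeightedSquareSummable.
Variables (R : realType) (I : choiceType) (w : I -> R[i]).
Hypothesis w_gt0 : forall i, 0 < w i.
Variable E : hilbertType R.
Implicit Types a b : I -> E.

Definition sqsummable a :=
  exists M, forall A : {fset I}, partial_sum (fun k => `|a k| ^+ 2 / w k) A <= M.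

Definition sumdot a b : R[i] := sum (fun k => '[a k, b k] / w k : R[i]^o).

Let term_ge0 a k : 0 <= `|a k| ^+ 2 / w k.
Proof. by rewrite divr_ge0 ?exprn_ge0 // ltW. Qed.

Lemma sqsummable0 : sqsummable (fun=> 0).
Proof.
exists 0 => A; rewrite partial_sumE big1 // => k _.
by rewrite normr0 expr0n mul0r.
Qed.

Lemma sqsummableP c a b :
  sqsummable a -> sqsummable b -> sqsummable (fun k => c *: a k + b k).
Proof.
move=> [M aM] [N bN]; exists (2 * `|c| ^+ 2 * M + 2 * N) => A.
apply: (@le_trans _ _ (2 * `|c| ^+ 2 * partial_sum (fun k => `|a k| ^+ 2 / w k) A
  + 2 * partial_sum (fun k => `|b k| ^+ 2 / w k) A)); last first.
  by rewrite lerD // ler_wpM2l // ?mulr_ge0 ?exprn_ge0.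
rewrite !partial_sumE !mulr_sumr -big_split; apply: ler_sum => k _ /=.
rewrite (mulrA (2 * `|c| ^+ 2)) (mulrA 2 (`|b k| ^+ 2)) -mulrDl ler_wpM2r ?invr_ge0 ?(ltW (w_gt0 _)) //.
have : `|c *: a k + b k| ^+ 2 <= (`|c| * `|a k| + `|b k|) ^+ 2.
  rewrite lerXn2r ?nnegrE ?addr_ge0 ?mulr_ge0 //.
  by rewrite (le_trans (ler_normD _ _)) // normrZ.
move=> /le_trans; apply.
have sq : (`|c| * `|a k| + `|b k|) ^+ 2 <= 2 * (`|c| * `|a k|) ^+ 2 + 2 * `|b k| ^+ 2.
  rewrite -subr_ge0 (_ : _ - _ = (`|c| * `|a k| - `|b k|) ^+ 2); last by ring.
  by rewrite real_exprn_even_ge0 // rpredB ?rpredM ?normr_real.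
by apply: le_trans sq _; rewrite exprMn (mulrA 2).
Qed.

Lemma hdot_polarization (x y : E) :
  4 * '[x, y] = `|x + y| ^+ 2 - `|x - y| ^+ 2
    + 'i * (`|x + 'i *: y| ^+ 2 - `|x - 'i *: y| ^+ 2).
Proof.
rewrite -!hdotxx !dnormB !dnormD /= !(linearZr_LR hdot) /=.
rewrite !rmorphM /= conjCi rmorphN /= conjCi opprK.
set p := '[x, y]; set q := p^*; set s := '[x]; set t := '['i *: y].
have i2 : 'i * 'i = -1 :> R[i] by rewrite -expr2 sqrCi.
transitivity ('[y] - '[y] + (1 - 'i * 'i) * 2 * p + (1 + 'i * 'i) * 2 * q).
  by rewrite i2; ring.
by ring.
Qed.

Lemma cvg_sumdot a b : sqsummable a -> sqsummable b ->
  (partial_sum (fun k => '[a k, b k] / w k) : {fset I} -> R[i]^o) @ totally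
    --> (sumdot a b : R[i]^o).
Proof.
move=> ha hb.
suff [l hl] : exists l : R[i]^o,
    (partial_sum (fun k => '[a k, b k] / w k) : {fset I} -> R[i]^o) @ totally --> l.
  rewrite (_ : sumdot a b = l) //.
  exact: (cvg_lim (@norm_hausdorff _ R[i]^o) hl).
have comb c : exists l : R[i]^o,
    (partial_sum (fun k => `|a k + c *: b k| ^+ 2 / w k) : {fset I} -> R[i]^o)
      @ totally --> l.
  have [M hM] := sqsummableP c hb ha.
  apply: (@cvg_partial_sum_bounded _ _ _ M) => [i|A].
    by rewrite divr_ge0 ?exprn_ge0 ?(ltW (w_gt0 _)).
  apply: le_trans (hM A); rewrite le_eqVlt; apply/orP; left; apply/eqP.
  by congr (partial_sum _ A); apply/funext => k; rewrite addrC.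
have [l1 h1] := comb 1.
have [l2 h2] := comb (-1).
have [l3 h3] := comb 'i.
have [l4 h4] := comb (- 'i).
have K (z l : R[i]^o) (u : {fset I} -> R[i]^o) : u A @[A --> totally] --> l ->
    (z * u A : R[i]^o) @[A --> totally] --> (z * l : R[i]^o).
  by move=> h; exact: (cvgM (cvg_cst z) h).
exists ((4^-1 : R[i]) * (l1 - l2 + 'i * (l3 - l4)) : R[i]^o).
pose P c A := partial_sum (fun k => `|a k + c *: b k| ^+ 2 / w k) A.
apply: (@cvg_eqfun _ _ _ _
  (fun A => 4^-1 * (P 1 A - P (-1) A + 'i * (P 'i A - P (- 'i) A)) : R[i]^o));
  last exact: (K 4^-1 _ _ (cvgD (cvgB h1 h2) (K 'i _ _ (cvgB h3 h4)))).
move=> A; rewrite /P /=.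
rewrite !partial_sumE; apply: (@mulfI _ 4); first by rewrite pnatr_eq0.
rewrite mulrA divff ?pnatr_eq0 // mul1r.
rewrite mulr_sumr -!sumrB mulr_sumr -big_split /=.
apply: eq_bigr => k _.
by rewrite mulrA hdot_polarization scale1r !scaleNr scale1r; ring.
Qed.

Lemma sumdotPl c a b d : sqsummable a -> sqsummable b -> sqsummable d ->
  sumdot (fun k => c *: a k + b k) d = c * sumdot a d + sumdot b d.
Proof.
move=> ha hb hd.
have h1 := cvg_sumdot (sqsummableP c ha hb) hd.
have h2 := cvgD (cvgM (cvg_cst (c : R[i]^o)) (cvg_sumdot ha hd)) (cvg_sumdot hb hd).
apply: (cvg_unique (@norm_hausdorff _ R[i]^o) h1).
apply: (@cvg_eqfun _ _ _ _ (fun A =>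
  c * partial_sum (fun k => '[a k, d k] / w k) A
  + partial_sum (fun k => '[b k, d k] / w k) A : R[i]^o)); last exact: h2.
move=> A.
rewrite !partial_sumE mulr_sumr -big_split; apply: eq_bigr => k _ /=.
by rewrite hdotPl mulrDl mulrA.
Qed.

Lemma sumdotC a b : sqsummable a -> sqsummable b -> sumdot b a = (sumdot a b)^*.
Proof.
move=> ha hb.
apply: (cvg_unique (@norm_hausdorff _ R[i]^o) (cvg_sumdot hb ha)).
apply/cvgrPdist_le => e e0.
have /cvgrPdist_le/(_ e e0) := cvg_sumdot ha hb.
apply: filterS => A /= h.
rewrite (_ : _ - _ = (sumdot a b - partial_sum (fun k => '[a k, b k] / w k) A)^*).
  by rewrite norm_conjC.
rewrite rmorphB /=; congr (_ - _).
rewrite !partial_sumE rmorph_sum /=; apply: eq_bigr => k _.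
by rewrite rmorphM /= -hdotC (CrealP _) // rpredV gtr0_real.
Qed.

Lemma le_sumdot a A : sqsummable a ->
  partial_sum (fun k => `|a k| ^+ 2 / w k) A <= sumdot a a.
Proof.
move=> ha; rewrite -lerN2.
apply: (@cvg_leC _ _ totally _
  (fun B => - partial_sum (fun k => '[a k, a k] / w k) B)).
  exact: (cvgN (cvg_sumdot ha ha)).
exists A => // B /= AB; rewrite lerN2.
apply: le_trans (le_partial_sum _ AB) _ => //.
by rewrite !partial_sumE; apply: ler_sum => k _; rewrite hdotxx.
Qed.

Lemma sumdot_le a M :
  (forall A : {fset I}, partial_sum (fun k => `|a k| ^+ 2 / w k) A <= M) ->
  sumdot a a <= M.
Proof.
move=> aM; have ha : sqsummable a by exists M.
apply: (cvg_leC (cvg_sumdot ha ha)); apply: nearW => A.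
have := aM A; rewrite (_ : (fun k => _) = (fun k => '[a k, a k] / w k)) //.
by apply/funext => k; rewrite hdotxx.
Qed.

Lemma le_term_sumdot a k : sqsummable a -> `|a k| ^+ 2 / w k <= sumdot a a.
Proof.
move=> ha; have := le_sumdot [fset k]%fset ha.
by rewrite partial_sumE big_seq_fset1.
Qed.

End WeightedSquareSummable.

Definition mindex (n : nat) := {ffun 'I_n -> nat}.

(* gamma k = |k|! / k! *)
Definition gamma (R : realType) (n : nat) (k : mindex n) : R[i] :=
  (\sum_i k i)`!%:R / (\prod_i (k i)`!)%:R.

Lemma gamma_gt0 (R : realType) (n : nat) (k : mindex n) : 0 < gamma R k.
Proof. by rewrite divr_gt0 // ltr0n ?fact_gt0 ?prodn_gt0 // => i; exact: fact_gt0. Qed.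

(* An element f of H2 n E is given by its Taylor coefficients f k; the analytic
   function it stands for is z |-> H2_eval f z, defined below. *)
Definition H2_pred (R : realType) (n : nat) (E : hilbertType R) : {pred mindex n -> E} :=
  fun a => `[< exists M : R[i], forall A : {fset mindex n},
    partial_sum (fun k => `|a k| ^+ 2 / gamma R k) A <= M >].

Section H2Type.
Variables (R : realType) (n : nat) (E : hilbertType R).

Let ge0 := @gamma_gt0 R n.

Let H2_pred_submod : submod_closed (@H2_pred R n E).
Proof.
split; first by apply/asboolP; exact: sqsummable0.
by move=> c a b /asboolP ha /asboolP hb; apply/asboolP; exact: (sqsummableP ge0).
Qed.

HB.instance Definition _ :=
  GRing.isSubmodClosed.Build R[i] (mindex n -> E) (@H2_pred R n E) H2_pred_submod.

Record H2 := MkH2 { H2_coef :> mindex n -> E; _ : H2_coef \in @H2_pred R n E }.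

HB.instance Definition _ := [isSub for H2_coef].
HB.instance Definition _ := [Choice of H2 by <:].
HB.instance Definition _ := [SubChoice_isSubLmodule of H2 by <:].

Lemma H2_sqsummable (f : H2) : sqsummable (@gamma R n) f.
Proof. exact/asboolP/(valP f). Qed.

Let fdot (f g : H2) : R[i] := sum (fun k => '[f k, g k] / gamma R k : R[i]^o).

Let fdotPl h : scalar (fdot^~ h).
Proof.
move=> c f g; rewrite -[RHS](sumdotPl ge0) //; exact: H2_sqsummable.
Qed.

Let fdotC f g : fdot g f = (fdot f g)^*.
Proof. by apply: (sumdotC ge0); exact: H2_sqsummable. Qed.

Let fdot_gt0 f : f != 0 -> 0 < fdot f f.
Proof.
move=> f0; rewrite lt_neqAle; apply/andP; split; last first.
  apply: le_trans (le_sumdot ge0 fset0 (H2_sqsummable f)).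
  by rewrite partial_sumE big_seq_fset0.
apply: contra f0 => /eqP hf; apply/eqP/val_inj/funext => k /=.
have := le_term_sumdot ge0 k (H2_sqsummable f).
rewrite [sumdot _ _ _](esym hf) pmulr_lle0 ?invr_gt0 ?ge0 // => fk.
apply/eqP; rewrite -normr_eq0 -sqrf_eq0 eq_le fk /=.
by rewrite exprn_ge0.
Qed.

HB.instance Definition _ := Lmodule_isPreHilbert.Build R H2 fdotPl fdotC fdot_gt0.

Let H2_normE (f : H2) : `|f| ^+ 2 = sumdot (@gamma R n) f f.
Proof. by rewrite -hdotxx. Qed.

Let le_coef (f : H2) k : `|f k| <= sqrtC (gamma R k) * `|f|.
Proof.
rewrite -(@ler_pXn2r _ 2) ?nnegrE ?mulr_ge0 ?sqrtC_ge0 ?(ltW (ge0 k)) //.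
rewrite exprMn sqrtCK mulrC -ler_pdivrMr ?ge0 // H2_normE.
exact: (le_term_sumdot ge0 k (H2_sqsummable f)).
Qed.

Let H2_complete (F : set_system H2) : ProperFilter F -> cauchy F -> cvg F.
Proof.
move=> FF cF.
have cvk k : exists l : E, (fun f : H2 => f k) @ F --> l.
  apply/cvg_ex; apply: cauchy_cvg; apply/cauchyP => e e0.
  have g0 : 0 < sqrtC (gamma R k) by rewrite sqrtC_gt0 ge0.
  have /cauchyP/(_ _ (divr_gt0 e0 g0))[f Ff] := cF.
  exists (f k); change (F ((fun f : H2 => f k) @^-1` ball (f k) e)).
  apply: filterS Ff => g; rewrite /preimage /mkset -!ball_normE /=.
  rewrite ltr_pdivlMr // mulrC => h.
  by apply: le_lt_trans h; exact: (le_coef (f - g) k).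
have [l Fl] := choice cvk.
have key e f : 0 < e -> F (ball f e) -> forall A : {fset mindex n},
    partial_sum (fun k => `|l k - f k| ^+ 2 / gamma R k) A <= e ^+ 2.
  move=> e0 Ff A; rewrite partial_sumE.
  have lim : (fun g : H2 => \sum_(k <- A) `|g k - f k| ^+ 2 / gamma R k : R[i]^o) @ F -->
             (\sum_(k <- A) `|l k - f k| ^+ 2 / gamma R k : R[i]^o).
    apply: cvg_sumC => k.
    have h := @cvg_sqrnorm _ _ _ _ FF _ _ (f k) (Fl k).
    exact: (cvgM h (cvg_cst ((gamma R k)^-1 : R[i]^o))).
  apply: (cvg_leC lim). apply: filterS Ff => g.
  rewrite -ball_normE /= => /ltW fg.
  have := le_sumdot ge0 A (H2_sqsummable (g - f)).
  rewrite partial_sumE => /le_trans; apply.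
  by rewrite -H2_normE distrC lerXn2r ?nnegrE ?(ltW e0).
have /cauchyP/(_ 1 ltr01)[f1 Ff1] := cF.
have lf1 : (fun k => l k - f1 k) \in @H2_pred R n E.
  by apply/asboolP; exists (1 ^+ 2); exact: (key 1 f1).
have lH : l \in @H2_pred R n E.
  rewrite (_ : l = (l - (f1 : mindex n -> E)) + (f1 : mindex n -> E)); last by rewrite subrK.
  by apply: rpredD; [exact: lf1|exact: (valP f1)].
apply/cvg_ex; exists (MkH2 lH); apply: cvg_approx => e e0.
have /cauchyP/(_ e e0)[f Ff] := cF.
exists f => //; rewrite -(@ler_pXn2r _ 2) ?nnegrE ?(ltW e0) // H2_normE.
by apply: sumdot_le => [k|A]; [exact: ge0|exact: key].
Qed.

HB.instance Definition _ := Uniform_isComplete.Build H2 H2_complete.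

End H2Type.

Definition is_bounded_op (R : realType) (H K : hilbertType R) (A : H -> K) :=
  linear A /\ exists2 M : R[i], 0 <= M & forall x, `|A x| <= M * `|x|.

Definition bop_pred (R : realType) (H K : hilbertType R) : {pred H -> K} :=
  fun A => `[< is_bounded_op A >].

Section BoundedOperators.
Variables (R : realType) (H K : hilbertType R).

Let bop_pred_submod : submod_closed (@bop_pred R H K).
Proof.
split.
  apply/asboolP; split; first by move=> a x y /=; rewrite scaler0 addr0.
  by exists 0 => // x; rewrite normr0 mul0r.
move=> c A B /asboolP[lA [M M0 hM]] /asboolP[lB [N N0 hN]]; apply/asboolP; split.
  move=> a x y; rewrite [LHS]/(c *: A _ + B _) lA lB.
  rewrite [RHS]/(a *: (c *: A x + B x) + (c *: A y + B y)).
  rewrite !scalerDr !scalerA (mulrC a). exact: addrACA.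
exists (`|c| * M + N) => [|x]; first by rewrite addr_ge0 ?mulr_ge0.
 rewrite [X in `|X|]/(c *: A x + B x).
rewrite (le_trans (ler_normD _ _)) // normrZ mulrDl lerD //.
by rewrite -mulrA ler_wpM2l.
Qed.

HB.instance Definition _ :=
  GRing.isSubmodClosed.Build R[i] (H -> K) (@bop_pred R H K) bop_pred_submod.

Record bop := MkBop { bop_fun :> H -> K; _ : bop_fun \in @bop_pred R H K }.

HB.instance Definition _ := [isSub for bop_fun].
HB.instance Definition _ := [Choice of bop by <:].
HB.instance Definition _ := [SubChoice_isSubLmodule of bop by <:].

Lemma bopP (A : bop) : is_bounded_op A.
Proof. exact/asboolP/(valP A). Qed.

Lemma bop_linear (A : bop) : linear A.
Proof. by have [] := bopP A. Qed.

HB.instance Definition _ (A : bop) :=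
  @GRing.isLinear.Build R[i] H K _ (bop_fun A) (bop_linear A).

Definition Bop (A : H -> K) (hA : is_bounded_op A) : bop := MkBop (asboolT hA).

End BoundedOperators.

Notation "''B' ( H , K )" := (bop H K)
  (at level 8, format "''B' ( H ,  K )") : type_scope.

Section Composition.
Variable R : realType.
Implicit Types H K L : hilbertType R.

Let id_subproof H : is_bounded_op (@id H).
Proof. by split => //; exists 1 => // x; rewrite mul1r. Qed.

Definition bid H : 'B(H, H) := Bop (id_subproof H).

Let comp_subproof H K L (A : 'B(K, L)) (B : 'B(H, K)) : is_bounded_op (A \o B).
Proof.
split; first by move=> c x y /=; rewrite !bop_linear.
have [_ [M M0 hM]] := bopP A; have [_ [N N0 hN]] := bopP B.
exists (M * N) => [|x /=]; first exact: mulr_ge0.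
by rewrite (le_trans (hM _)) // -mulrA ler_wpM2l.
Qed.

Definition bcomp H K L (A : 'B(K, L)) (B : 'B(H, K)) : 'B(H, L) :=
  Bop (comp_subproof A B).

Lemma incl_subproof H (M : clsubspace H) : is_bounded_op (@cls_val R H M).
Proof.
by split=> //; exists 1 => // x; rewrite mul1r cls_normE.
Qed.

Definition bincl H (M : clsubspace H) : 'B(cls_type M, H) := Bop (incl_subproof M).

End Composition.

Infix "\ob" := bcomp (at level 40, left associativity) : ring_scope.

Section RowOperator.
Variables (R : realType) (n : nat) (H : hilbertType R) (T : 'I_n -> 'B(H, H)).

Let row_subproof : is_bounded_op (fun h : hpow n H => \sum_i T i (h i)).
Proof.
split.
  move=> c x y; rewrite scaler_sumr -big_split; apply: eq_bigr => i _ /=.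
  by rewrite !ffunE linearP.
have hT i : exists M : R[i], 0 <= M /\ forall x, `|T i x| <= M * `|x|.
  by have [_ [M M0 hM]] := bopP (T i); exists M.
have [M hM] := choice hT.
exists (\sum_i M i) => [|h]; first by apply: sumr_ge0 => i _; have [] := hM i.
rewrite mulr_suml; apply: le_trans (ler_norm_sum _ _ _) _; apply: ler_sum => i _.
have [M0 hMi] := hM i; apply: le_trans (hMi _) _; rewrite ler_wpM2l //.
exact: hpow_le_coord.
Qed.

Definition rowop : 'B(hpow n H, H) := Bop row_subproof.

End RowOperator.

(* In this section xget 0 P is the unique operator satisfying P, and 0 when
   there is none; for adj, proj_op, and sqrt_op of a positive operator, there
   always is one. *)
Section Adjoints.
Variable R : realType.
Implicit Types H K : hilbertType R.

Definition adj H K (A : 'B(H, K)) : 'B(K, H) :=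
  xget 0 [set B : 'B(K, H) | forall x y, '[A x, y] = '[x, B y]].

Definition binv H K (A : 'B(H, K)) : 'B(K, H) :=
  xget 0 [set B : 'B(K, H) | A \ob B = bid K /\ B \ob A = bid H].

Definition positive_op H (A : 'B(H, H)) := forall x, 0 <= '[A x, x].

Definition sqrt_op H (A : 'B(H, H)) : 'B(H, H) :=
  xget 0 [set S | positive_op S /\ S \ob S = A].

Definition proj_op H (M : clsubspace H) : 'B(H, cls_type M) :=
  xget 0 [set P : 'B(H, cls_type M) |
    forall (x : H) (y : cls_type M), '[x - bincl M (P x), bincl M y] = 0].

Definition compression H (M : clsubspace H) (A : 'B(H, H)) : 'B(cls_type M, cls_type M) :=
  proj_op M \ob A \ob bincl M.

Definition unitary_op H K (U : 'B(H, K)) :=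
  adj U \ob U = bid H /\ U \ob adj U = bid K.

End Adjoints.

Section ClosedSubspaces.
Variable R : realType.
Implicit Types H K : hilbertType R.

Let closure_normP H (S : set H) x :
  closure S x <-> forall e : R[i], 0 < e -> exists2 y, S y & `|x - y| < e.
Proof.
split=> [hx e e0|hx U /nbhs_ballP[e e0 eU]].
  have [y [Sy xy]] := hx _ (nbhsx_ballx x e e0).
  by exists y => //; move: xy; rewrite -ball_normE.
have [y Sy xy] := hx e e0.
by exists y; split=> //; apply: eU; rewrite -ball_normE.
Qed.

Let closure_range0 H K (A : 'B(H, K)) : closure (range A) 0.
Proof. by apply: subset_closure; exists 0 => //; rewrite linear0. Qed.

Let closure_rangeP H K (A : 'B(H, K)) a x y :
  closure (range A) x -> closure (range A) y -> closure (range A) (a *: x + y).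
Proof.
move=> /closure_normP hx /closure_normP hy; apply/closure_normP => e e0.
have a1 : 0 < `|a| + 1 by rewrite ltr_wpDl.
have [_ [u _ <-] xu] := hx _ (divr_gt0 (divr_gt0 e0 (ltr0Sn _ 1)) a1).
have [_ [v _ <-] yv] := hy _ (divr_gt0 e0 (ltr0Sn _ 1)).
exists (A (a *: u + v)); first by exists (a *: u + v).
rewrite linearP opprD addrACA -scalerBr (splitr e).
rewrite (le_lt_trans (ler_normD _ _)) // ler_ltD // normrZ.
rewrite ltr_pdivlMr // in xu.
by apply: le_trans (ltW xu); rewrite mulrC ler_wpM2l // lerDl.
Qed.

Definition closed_range H K (A : 'B(H, K)) : clsubspace K :=
  @ClSubspace R K (closure (range A))
    (@closure_range0 H K A) (@closure_rangeP H K A) (@closed_closure _ (range A)).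

Lemma in_closed_range H K (A : 'B(H, K)) x : A x \in cls_pred (closed_range A).
Proof. by apply/asboolP; apply: subset_closure; exists x. Qed.

Definition corange H K (A : 'B(H, K)) (x : H) : cls_type (closed_range A) :=
  ClsElt (in_closed_range A x).

Definition orthocomplement_set H (S : set H) : set H :=
  [set x | forall y, S y -> '[x, y] = 0].

Let ortho0 H (S : set H) : orthocomplement_set S 0.
Proof. by move=> y _; rewrite linear0l. Qed.

Let orthoP H (S : set H) a x y : orthocomplement_set S x ->
  orthocomplement_set S y -> orthocomplement_set S (a *: x + y).
Proof. by move=> hx hy z Sz; rewrite hdotPl hx // hy // mulr0 addr0. Qed.

Let ortho_closed H (S : set H) : closed (orthocomplement_set S).
Proof.
move=> x /closure_normP hx y Sy; apply/eqP; apply: contraT => xy0.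
have xy : 0 < `|'[x, y]| by rewrite normr_gt0.
have y1 : 0 < `|y| + 1 by rewrite ltr_wpDl.
have [z hz xz] := hx _ (divr_gt0 xy y1).
rewrite ltr_pdivlMr // in xz.
have := dot_CauchySchwarz hdot (x - z) y.
rewrite (_ : x - z = -1 *: z + x); last by rewrite scaleN1r addrC.
rewrite hdotPl (hz _ Sy) mulr0 add0r -!hnormE scaleN1r addrC => h.
have := le_lt_trans h (le_lt_trans _ xz).
by rewrite ltxx; apply; rewrite ler_wpM2l // lerDl.
Qed.

Definition orthocomplement H (S : set H) : clsubspace H :=
  @ClSubspace R H (orthocomplement_set S) (@ortho0 H S) (@orthoP H S) (@ortho_closed H S).

End ClosedSubspaces.

Section MultiplicationOperators.
Variables (R : realType) (n : nat).
Implicit Types E F : hilbertType R.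

Definition unit_ball : set ('I_n -> R[i]) := [set z | \sum_i `|z i| ^+ 2 < 1].

Definition H2_eval E (f : H2 n E) (z : 'I_n -> R[i]) : E :=
  sum (fun k : mindex n => (\prod_i z i ^+ k i) *: f k).

(* Multiplication by phi; it is well defined when phi is a multiplier, since the
   coefficients of f are determined by z |-> H2_eval f z. *)
Definition mul_op E F (phi : ('I_n -> R[i]) -> E -> F) : 'B(H2 n E, H2 n F) :=
  xget 0 [set M : 'B(H2 n E, H2 n F) | forall f z, unit_ball z ->
    H2_eval (M f) z = phi z (H2_eval f z)].

(* M_{z_i} (x) I_E, under the identification of H2 n E with H2 n C (x) E *)
Definition Mz E (i : 'I_n) : 'B(H2 n E, H2 n E) := mul_op (fun z x => z i *: x).

End MultiplicationOperators.

Section CommutingContractions.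
Variables (R : realType) (n : nat).
Implicit Types H K : hilbertType R.

Definition commuting_contractive H (T : 'I_n -> 'B(H, H)) :=
  (forall i j, T i \ob T j = T j \ob T i) /\
  positive_op (bid H - \sum_i (T i \ob adj (T i))).

Definition coisometric H (T : 'I_n -> 'B(H, H)) :=
  forall h : H, `|adj (rowop T) h| = `|h|.

Definition completely_noncoisometric H (T : 'I_n -> 'B(H, H)) :=
  ~ exists M : clsubspace H,
    [/\ exists2 h, cls_set M h & h != 0,
        forall i h, cls_set M h -> cls_set M (adj (T i) h)
      & coisometric (fun i => compression M (T i))].

Definition unitarily_equivalent H K (T : 'I_n -> 'B(H, H)) (S : 'I_n -> 'B(K, K)) :=
  exists U : 'B(K, H), unitary_op U /\ forall i, T i = U \ob S i \ob adj U.

End CommutingContractions.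

Section CharacteristicFunction.
Variables (R : realType) (n : nat) (H : hilbertType R) (T : 'I_n -> 'B(H, H)).

Definition defect_star : 'B(H, H) :=
  sqrt_op (bid H - rowop T \ob adj (rowop T)).

Definition defect : 'B(hpow n H, hpow n H) :=
  sqrt_op (bid (hpow n H) - adj (rowop T) \ob rowop T).

Definition defect_star_space : hilbertType R := cls_type (closed_range defect_star).

Definition defect_space : hilbertType R := cls_type (closed_range defect).

(* theta_T(z) = - T + D_T* (1 - Z T* )^-1 Z D_T, before restriction *)
Definition char_op (z : 'I_n -> R[i]) : 'B(hpow n H, H) :=
  let Z := rowop (fun i => z i *: bid H) in
  - rowop T
  + defect_star \ob binv (bid H - Z \ob adj (rowop T)) \ob Z \ob defect.

(* theta_T(z) restricted to the closed range of D_T; since T D_T = D_T* T, it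
   takes its values in the closed range of D_T* and the default of insubd is
   not used. *)
Definition char_fun (z : 'I_n -> R[i]) (x : defect_space) : defect_star_space :=
  insubd (0 : defect_star_space) (char_op z (cls_val x)).

Definition M_char : 'B(H2 n defect_space, H2 n defect_star_space) := mul_op char_fun.

Definition Delta : 'B(H2 n defect_space, H2 n defect_space) :=
  sqrt_op (bid (H2 n defect_space) - adj M_char \ob M_char).

(* the inverse of Delta : (Ker Delta)^_|_ -> Ran Delta *)
Definition Delta_inv : H2 n defect_space -> H2 n defect_space :=
  'pinv_(fun=> 0) (cls_set (orthocomplement [set v | Delta v = 0])) Delta.

Definition model_sum : hilbertType R :=
  hsum (H2 n defect_star_space) (cls_type (closed_range Delta)).

Definition model_space : clsubspace model_sum :=
  orthocomplement [set ((M_char u, corange Delta u) : model_sum) | u in setT].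

End CharacteristicFunction.

Arguments char_fun {R n H} T z x.
Arguments Delta_inv {R n H} T _.

(* Main.v *)
(** Write [A'] for the adjoint of [A], [M] for multiplication by the characteristic
    function [theta], [K_z] for the reproducing kernel of H^2 at [z], [Ds] for the
    defect operator of [T'] and [R_z] for the inverse of [1 - Z T']. The identity
    [theta(z) theta(w)' + (1 - <z, w>) Ds R_z R_w' Ds = 1] says that
    [K_w x |-> (K_w theta(w)' x, R_w' Ds x)] preserves inner products; hence it
    extends to an isometry, whose two components are the adjoints of [M] and of a
    map [Pi] from [H] with [(Pi h)(z) = Ds R_z h], and [M M' + Pi Pi' = 1].
    Comparing Taylor coefficients gives [M_{z_i}' Pi = Pi T_i'], so [ker Pi] is
    invariant under the [T_i'] and [T] compresses to a co-isometry there: for a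
    c.n.c. tuple, [Pi] is injective. The projection [Q] of the model space to its
    first component is injective too, and [Q Q' = 1 - M M' = Pi Pi'], so
    [Q' u |-> Pi' u] extends to a unitary [U] with [Pi U = Q]; the formula for
    the model tuple is read off from [U' T_i' U]. *)

Require Import Defs.
From HB Require Import structures.
From mathcomp Require Import all_boot all_order all_algebra.
From mathcomp Require Import finmap complex boolp classical_sets functions filter reals.
From mathcomp Require Import topology normedtype summability ring.

Set Implicit Arguments.
Unset Strict Implicit.
Unset Printing Implicit Defensive.

Import Order.TTheory GRing.Theory Num.Def Num.Theory.
Import numFieldNormedType.Exports.

Local Open Scope classical_set_scope.
Local Open Scope ring_scope.

(** * Hilbert space operators *)

(** The definitions select adjoints, square roots, inverses and multiplication operators by choice,
    so each use needs existence, and uniqueness where the condition alone must identify the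
    operator: the Riesz theorem, a dominated iteration, the Neumann series, and for [mul_op] the
    fact that values on the ball determine Taylor coefficients. This last fact is the obstacle in
    several variables, where many monomials share a degree; a curve on which one term has strictly
    smallest order settles it. Boundedness of multiplication by the characteristic function is not
    estimated: the isometry on kernels produces the operator, and [mul_op_unique] recognises it.
    Membership in a closed range is tested by orthogonality to the kernel of the adjoint. A model
    vector [(u, v)] satisfies [M' u + Delta v = 0]; hence its first coordinate determines it, and
    [Delta v] moves under the adjoint shifts along with [M' u], because [M'] intertwines them. *)

Section ComplexOrder.
Variable R : realType.

Lemma eq0_small_le (g c : R[i]) : 0 <= g -> 0 <= c ->
  (forall s, 0 < s -> g <= s * c) -> g = 0.
Proof.
move=> g0 c0 h; apply/eqP; rewrite eq_le g0 andbT real_leNgt ?ger0_real //; apply/negP => gp.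
have c1 : 0 < c + 1 by rewrite ltr_wpDl.
have := h (g / (c + 1)) (divr_gt0 gp c1).
rewrite mulrAC ler_pdivlMr // mulrDr mulr1 gerDl => /(lt_le_trans gp).
by rewrite ltxx.
Qed.

(** Numbers of [R[i]] are comparable only when their difference is real; the common lower bound [m]
    puts all values on the line [m + R], where the infimum of the reals is available. *)
Lemma inf_realC (T : Type) (t0 : T) (S : T -> R[i]) (m : R[i]) :
  (forall t, m <= S t) ->
  exists d, (forall t, d <= S t) /\ forall e, 0 < e -> exists t, S t < d + e.
Proof.
move=> mS.
pose A := [set complex.Re (S t - m) | t in [set: T]].
have SE t : S t = m + (complex.Re (S t - m))%:C%C.
  by rewrite RRe_real ?ger0_real ?subr_ge0 // addrC subrK.
have A0 : lbound A 0.
  by move=> _ [t _ <-]; rewrite -lecR -[leRHS](addKr m) -SE addrC subr_ge0.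
have iA : has_inf A by split; [exists (complex.Re (S t0 - m)), t0|exists 0].
exists (m + (inf A)%:C%C); split=> [t|e e0].
  by rewrite SE lerD2l lecR; apply: ge_inf; [exists 0|exists t].
have er : e = (complex.Re e)%:C%C by rewrite RRe_real // gtr0_real.
have re0 : 0 < complex.Re e by rewrite -ltcR -er.
have [_ [t _ <-] h] := inf_adherent re0 iA.
by exists t; rewrite SE -addrA ltrD2l er -rmorphD ltcR.
Qed.

End ComplexOrder.

(** * Inner products and Riesz representation *)

Section HilbertBasics.
Variable R : realType.
Implicit Types H K L : hilbertType R.

Lemma hdotDl H (x y z : H) : '[x + y, z] = '[x, z] + '[y, z].
Proof. exact: linearDl. Qed.

Lemma hdotBl H (x y z : H) : '[x - y, z] = '[x, z] - '[y, z].
Proof. exact: linearBl. Qed.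

Lemma hdotZl H a (x z : H) : '[a *: x, z] = a * '[x, z].
Proof. exact: linearZl_LR. Qed.

Lemma hdotDr H (x y z : H) : '[z, x + y] = '[z, x] + '[z, y].
Proof. exact: linearDr. Qed.

Lemma hdotBr H (x y z : H) : '[z, x - y] = '[z, x] - '[z, y].
Proof. exact: linearBr. Qed.

Lemma hdotZr H a (x z : H) : '[z, a *: x] = a^* * '[z, x].
Proof. exact: linearZr_LR. Qed.

Lemma hdot0l H (z : H) : '[0, z] = 0.
Proof. exact: linear0l. Qed.

Lemma hdot0r H (z : H) : '[z, 0] = 0.
Proof. exact: linear0r. Qed.

Lemma hdotNl H (x z : H) : '[- x, z] = - '[x, z].
Proof. exact: linearNl. Qed.

Lemma hdotNr H (x z : H) : '[z, - x] = - '[z, x].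
Proof. exact: linearNr. Qed.

Lemma hdot_suml H (I : Type) (r : seq I) (F : I -> H) z :
  '[\sum_(i <- r) F i, z] = \sum_(i <- r) '[F i, z].
Proof.
elim: r => [|i r IH]; first by rewrite !big_nil hdot0l.
by rewrite !big_cons hdotDl IH.
Qed.

Lemma hdot_sumr H (I : Type) (r : seq I) (F : I -> H) z :
  '[z, \sum_(i <- r) F i] = \sum_(i <- r) '[z, F i].
Proof.
elim: r => [|i r IH]; first by rewrite !big_nil hdot0r.
by rewrite !big_cons hdotDr IH.
Qed.

Lemma hdot_ge0 H (x : H) : 0 <= '[x].
Proof. exact: dnorm_ge0. Qed.

Lemma hdot_eq0 H (x : H) : '[x] = 0 -> x = 0.
Proof. by move/eqP; rewrite dnorm_eq0 => /eqP. Qed.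

Lemma hdot_inj H (x y : H) : (forall z, '[x, z] = '[y, z]) -> x = y.
Proof. by move=> h; apply/subr0_eq/hdot_eq0; rewrite hdotBl h subrr. Qed.

Lemma hdot_injr H (x y : H) : (forall z, '[z, x] = '[z, y]) -> x = y.
Proof. by move=> h; apply: hdot_inj => z; rewrite hdotC h -hdotC. Qed.

Lemma hdot_norm_le H (x y : H) : `|'[x, y]| <= `|x| * `|y|.
Proof. by rewrite !hnormE; exact: (dot_CauchySchwarz hdot). Qed.

Lemma norm_eq_hdot H K (x : H) (y : K) : '[x] = '[y] -> `|x| = `|y|.
Proof. by move=> h; rewrite !hnormE h. Qed.

Lemma norm_le_hdot H K (x : H) (y : K) : '[x] <= '[y] -> `|x| <= `|y|.
Proof.
by move=> h; rewrite -(@ler_pXn2r _ 2) ?nnegrE // -!hdotxx.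
Qed.

Lemma cvg_hdotl H (T : Type) (F : set_system T) (FF : ProperFilter F)
    (u : T -> H) (l z : H) :
  u t @[t --> F] --> l -> ('[u t, z] : R[i]^o) @[t --> F] --> ('[l, z] : R[i]^o).
Proof.
move=> ul; apply/cvgrPdist_le => e e0.
have z1 : 0 < `|z| + 1 by rewrite ltr_wpDl.
move/cvgrPdist_le: ul => /(_ _ (divr_gt0 e0 z1)); apply: filterS => t.
rewrite -hdotBl ler_pdivlMr // => h.
by apply: le_trans (hdot_norm_le _ _) (le_trans _ h); rewrite ler_wpM2l // lerDl.
Qed.

Lemma cvg_hdotr H (T : Type) (F : set_system T) (FF : ProperFilter F)
    (u : T -> H) (l z : H) :
  u t @[t --> F] --> l -> ('[z, u t] : R[i]^o) @[t --> F] --> ('[z, l] : R[i]^o).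
Proof.
move=> ul; apply/cvgrPdist_le => e e0.
have /cvgrPdist_le/(_ e e0) := cvg_hdotl (z := z) FF ul; apply: filterS => t.
by rewrite -hdotBl -hdotBr hdotC norm_conjC.
Qed.

(* Replace [x] by a small multiple of itself. *)
Lemma variation0 H (g : H -> R[i]) (q : H -> R[i]) :
  (forall a x, g (a *: x) = a * g x) -> (forall a x, q (a *: x) = `|a| ^+ 2 * q x) ->
  (forall x, 0 <= q x) -> (forall x, 0 <= q x + (g x + (g x)^*)) ->
  forall x, g x = 0.
Proof.
move=> gZ qZ q0 h x; apply/eqP; rewrite -normr_eq0 -sqrf_eq0; apply/eqP.
have c0 : 0 <= `|g x| ^+ 2 * q x / 2 by rewrite divr_ge0 ?mulr_ge0 ?exprn_ge0.
apply: (eq0_small_le _ c0) => [|s s0]; first by rewrite exprn_ge0.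
(* With this multiplier the linear part becomes [- 2 s |g x|^2], while the quadratic part has order
   [s^2]; dividing by [2 s] leaves a bound of the form required by [eq0_small_le]. *)
have := h (- (s * (g x)^*) *: x); rewrite gZ qZ !rmorphM /= rmorphN /= rmorphM /= conjCK.
rewrite (CrealP (gtr0_real s0)) normrN normrM norm_conjC (gtr0_norm s0).
have -> : (s * `|g x|) ^+ 2 * q x + (- (s * (g x)^*) * g x + - (s * g x) * (g x)^*)
   = (2 * s) * (s * (`|g x| ^+ 2 * q x / 2) - g x * (g x)^*) by field.
by rewrite -normCK pmulr_rge0 ?mulr_gt0 // subr_ge0.
Qed.

Lemma riesz H (phi : H -> R[i]) : scalar phi ->
  (exists M, 0 <= M /\ forall x, `|phi x| <= M * `|x|) ->
  exists y, forall x, phi x = '[x, y].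
Proof.
move=> phiP [M [M0 hM]].
have phi0 : phi 0 = 0.
  by have := phiP (-1) 0 0; rewrite scaler0 addr0 mulN1r addNr.
have phiZ a x : phi (a *: x) = a * phi x by have := phiP a x 0; rewrite phi0 !addr0.
have phiD x y : phi (x + y) = phi x + phi y by have := phiP 1 x y; rewrite scale1r mul1r.
pose r x := phi x + (phi x)^*.
have rreal x : r x \is Num.real by rewrite CrealE rmorphD /= conjCK addrC.
have rle x : r x <= 2 * (M * `|x|).
  rewrite (le_trans (real_ler_norm _)) // (le_trans (ler_normD _ _)) //.
  by rewrite norm_conjC -[leLHS]mulr2n -[leLHS]mulr_natl ler_wpM2l.
pose F x := '[x] - r x.
have Fge x : - M ^+ 2 <= F x.
  rewrite -subr_ge0 /F.
  have -> : '[x] - r x - - M ^+ 2 = (M - `|x|) ^+ 2 + (2 * (M * `|x|) - r x).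
    by rewrite hdotxx; ring.
  by rewrite addr_ge0 ?subr_ge0 // real_exprn_even_ge0 // rpredB ?ger0_real.
(* The representing vector minimises [F]; the parallelogram law makes
   minimising filters Cauchy. *)
have [d [dF Fd]] := inf_realC 0 Fge.
pose B e := [set x | F x < d + e].
have FB : ProperFilter (filter_from [set e : R[i] | 0 < e] B).
  apply: filter_from_proper; last by move=> e /Fd.
  apply: filter_from_filter; first by exists 1 => /=.
  move=> e e' /= e0 e'0.
  have ee' : (e <= e') || (e' <= e).
    by apply: real_leVge; exact: gtr0_real.
  have [le|le] := orP ee'.
    by exists e => // x xe; split=> //; apply: lt_le_trans xe _; rewrite lerD2l.
  by exists e' => // x xe; split=> //; apply: lt_le_trans xe _; rewrite lerD2l.
have close x y e : F x < d + e -> F y < d + e -> '[x - y] <= 4 * e.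
  move=> /ltW xe /ltW ye.
  have := dF (2^-1 *: (x + y)).
  have E : '[x - y] = 2 * F x + 2 * F y - 4 * F (2^-1 *: (x + y)).
    rewrite /F /r phiZ phiD hdotZl hdotZr !hdotDl !hdotDr !hdotNl !hdotNr.
    have c2 : (2^-1)^* = 2^-1 :> R[i] by rewrite fmorphV rmorph_nat.
    by rewrite !rmorphM !rmorphD /= c2; field.
  move=> h; rewrite E lerBlDr.
  have -> : 4 * e + 4 * F (2^-1 *: (x + y)) =
      2 * (d + e) + 2 * (d + e) + 4 * (F (2^-1 *: (x + y)) - d) by ring.
  rewrite -[leLHS]addr0 lerD ?mulr_ge0 ?subr_ge0 //.
  by rewrite lerD // ler_wpM2l.
have cB : cauchy (filter_from [set e : R[i] | 0 < e] B).
  apply/cauchyP => e e0.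
  have e1 : 0 < e ^+ 2 / 8 by rewrite divr_gt0 ?exprn_gt0.
  have [x xe] := Fd _ e1.
  exists x, (e ^+ 2 / 8) => // y ye; rewrite -ball_normE /=.
  rewrite -(@ltr_pXn2r _ 2) ?nnegrE ?(ltW e0) // -hdotxx.
  apply: le_lt_trans (close _ _ _ xe ye) _.
  rewrite -subr_gt0.
  have -> : e ^+ 2 - 4 * (e ^+ 2 / 8) = e ^+ 2 / 2 by field.
  by rewrite divr_gt0 ?exprn_gt0.
have : cvg (filter_from [set e : R[i] | 0 < e] B) by exact: cauchy_cvg.
set y : H := lim _ => yl.
exists y => x; apply/eqP; rewrite -subr_eq0 -oppr_eq0 opprB; apply/eqP.
apply: (variation0 (g := fun x => '[x, y] - phi x) (q := fun x => '[x])).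
- by move=> a z; rewrite hdotZl phiZ mulrBr.
- by move=> a z; rewrite hdotZl hdotZr mulrA -normCK.
- exact: hdot_ge0.
move=> z.
(* The expression is [F (t + z) - F t], in which the quadratic terms in [t] cancel. Its limit along
   the minimising filter needs only continuity of the inner product, and [F y = d] need not be
   known. *)
have lim : ('[z] + ('[z, t] + '[t, z] - r z) : R[i]^o)
    @[t --> filter_from [set e : R[i] | 0 < e] B] -->
    ('[z] + ('[z, y] + '[y, z] - r z) : R[i]^o).
  apply: (cvgD (cvg_cst _)); apply: cvgB (cvg_cst _).
  exact: cvgD (cvg_hdotr (z := z) FB yl) (cvg_hdotl (z := z) FB yl).
rewrite [X in 0 <= X](_ : _ = '[z] + ('[z, y] + '[y, z] - r z)); last first.
  by rewrite rmorphB /= -hdotC /r; ring.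
set v := (X in 0 <= X).
have ve e : 0 < e -> 0 <= v + e.
  move=> e0; apply: (cvg_ge0C (cvgD lim (cvg_cst (e : R[i]^o)))).
  exists e => // t te /=.
  have -> : '[z] + ('[z, t] + '[t, z] - r z) + e = F (t + z) - d + (d + e - F t).
    by rewrite /F /r phiD !hdotDl !hdotDr rmorphD /=; ring.
  by rewrite addr_ge0 ?subr_ge0 // ltW.
have vr : v \is Num.real.
  by rewrite -(addrK 1 v) rpredB ?ger0_real ?ve.
rewrite (real_leNgt (real0 _) vr); apply/negP => v0.
have := ve (- v / 2); rewrite divr_gt0 ?oppr_gt0 // => /(_ isT).
have -> : v + - v / 2 = v / 2 by field.
by rewrite pmulr_lge0 ?invr_gt0 // => /(lt_le_trans v0); rewrite ltxx.
Qed.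

(** * Bounded operators, adjoints and projections *)

Lemma bop_eqP H K (A B : 'B(H, K)) : (forall x, A x = B x) -> A = B.
Proof. by move=> AB; apply/val_inj/funext => x; exact: AB. Qed.

Lemma bop_bound H K (A : 'B(H, K)) : exists M, 0 <= M /\ forall x, `|A x| <= M * `|x|.
Proof. by have [_ [M M0 hM]] := bopP A; exists M. Qed.

Lemma bop_addE H K (A B : 'B(H, K)) x : (A + B) x = A x + B x.
Proof. by []. Qed.

Lemma bop_subE H K (A B : 'B(H, K)) x : (A - B) x = A x - B x.
Proof. by []. Qed.

Lemma bop_scaleE H K a (A : 'B(H, K)) x : (a *: A) x = a *: A x.
Proof. by []. Qed.

Lemma bop_sumE H K (I : Type) (r : seq I) (A : I -> 'B(H, K)) x :
  (\sum_(i <- r) A i) x = \sum_(i <- r) A i x.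
Proof. by elim: r => [|i r IH]; rewrite ?big_nil // !big_cons bop_addE IH. Qed.

Lemma bop_compE H K L (A : 'B(K, L)) (B : 'B(H, K)) x : (A \ob B) x = A (B x).
Proof. by []. Qed.

Lemma bidE H (x : H) : bid H x = x.
Proof. by []. Qed.

Lemma orthocomplementP H (S : set H) x :
  cls_set (orthocomplement S) x <-> forall y, S y -> '[x, y] = 0.
Proof. by []. Qed.

Lemma hlim_unique H (u : nat -> H) (l l' : H) :
  u n @[n --> \oo] --> l -> u n @[n --> \oo] --> l' -> l = l'.
Proof. by move=> ul ul'; apply: (cvg_unique (@norm_hausdorff _ _) ul ul'). Qed.

Lemma bop_cvg H K (A : 'B(H, K)) (T : Type) (F : set_system T) (FF : ProperFilter F)
    (u : T -> H) l : u t @[t --> F] --> l -> A (u t) @[t --> F] --> A l.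
Proof.
move=> ul; apply/cvgrPdist_le => e e0.
have [M [M0 hM]] := bop_bound A.
have M1 : 0 < M + 1 by rewrite ltr_wpDl.
have /cvgrPdist_le/(_ _ (divr_gt0 e0 M1)) := ul; apply: filterS => t.
rewrite -raddfB ler_pdivlMr // => h.
apply: le_trans (hM _) (le_trans _ h).
by rewrite mulrC ler_wpM2l // lerDl.
Qed.

Lemma bopD H K (A : 'B(H, K)) x y : A (x + y) = A x + A y.
Proof. exact: raddfD. Qed.

Lemma bopB H K (A : 'B(H, K)) x y : A (x - y) = A x - A y.
Proof. exact: raddfB. Qed.

Lemma bopN H K (A : 'B(H, K)) x : A (- x) = - A x.
Proof. exact: raddfN. Qed.

Lemma bop0 H K (A : 'B(H, K)) : A 0 = 0.
Proof. exact: raddf0. Qed.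

Lemma bopZ H K (A : 'B(H, K)) a x : A (a *: x) = a *: A x.
Proof. exact: linearZ. Qed.

Lemma bop_sum H K (A : 'B(H, K)) (I : Type) (r : seq I) (F : I -> H) :
  A (\sum_(i <- r) F i) = \sum_(i <- r) A (F i).
Proof. exact: raddf_sum. Qed.

(** Riesz representation of [x |-> '[A x, y]] supplies an operator, so the choice in [adj] does not
    fall back on its default. *)
Lemma adjP H K (A : 'B(H, K)) x y : '[A x, y] = '[x, adj A y].
Proof.
suff : exists B : 'B(K, H), forall x y, '[A x, y] = '[x, B y].
  by move=> [B hB]; rewrite /adj; case: xgetP => [C _ /= -> //|/(_ B)/= []].
have [M [M0 hM]] := bop_bound A.
have /choice[B hB] : forall y, exists z, forall x, '[A x, y] = '[x, z].
  move=> {}y; apply: (riesz (phi := fun x => '[A x, y])).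
    by move=> a u v; rewrite linearP hdotPl.
  exists (M * `|y|); split=> [|u]; first by rewrite mulr_ge0.
  by rewrite (le_trans (hdot_norm_le _ _)) // mulrAC ler_wpM2r.
have lB : linear B.
  move=> a u v; apply: hdot_injr => z.
  by rewrite -hB !hdotDr !hdotZr !hB.
suff bB : is_bounded_op B by exists (Bop bB).
split=> //; exists M => // u.
have [->|Bu0] := eqVneq (B u) 0; first by rewrite normr0 mulr_ge0.
rewrite -(@ler_pM2l _ `|B u|) ?normr_gt0 // -expr2 -hdotxx -hB.
rewrite (le_trans (real_ler_norm _)) ?hB ?ger0_real ?hdot_ge0 // -hB.
by rewrite (le_trans (hdot_norm_le _ _)) // mulrCA mulrA ler_wpM2r.
Qed.

Lemma adjPr H K (A : 'B(H, K)) x y : '[adj A x, y] = '[x, A y].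
Proof. by rewrite hdotC -adjP -hdotC. Qed.

Lemma adj_unique H K (A : 'B(H, K)) (B : 'B(K, H)) :
  (forall x y, '[A x, y] = '[x, B y]) -> adj A = B.
Proof.
move=> h; apply: bop_eqP => y; apply: hdot_inj => z.
by rewrite adjPr [RHS]hdotC -h -hdotC.
Qed.

Lemma adjK H K (A : 'B(H, K)) : adj (adj A) = A.
Proof. by apply: adj_unique => x y; rewrite adjPr. Qed.

Lemma adj_comp H K L (A : 'B(K, L)) (B : 'B(H, K)) :
  adj (A \ob B) = adj B \ob adj A.
Proof. by apply: adj_unique => x y /=; rewrite !adjP. Qed.

Lemma adj_eq0 H K (A : 'B(H, K)) y : (forall x, '[y, A x] = 0) -> adj A y = 0.
Proof. by move=> h; apply: hdot_inj => z; rewrite adjPr h hdot0l. Qed.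

(** Reduces projections to adjoint calculus, so that their existence needs no second minimisation
    argument. *)
Lemma proj_opE H (M : clsubspace H) : proj_op M = adj (bincl M).
Proof.
have inclE (x y : cls_type M) : '[x, y] = '[bincl M x, bincl M y] by [].
rewrite /proj_op; case: xgetP => [P _ /= hP|/(_ (adj (bincl M))) /= []].
  apply/esym/adj_unique => x y; apply/eqP; rewrite inclE.
  by rewrite -subr_eq0 -hdotBr hdotC hP conjC0.
move=> x y; apply/eqP; rewrite hdotBl subr_eq0; apply/eqP.
exact: esym (adjPr (bincl M) x y).
Qed.

Lemma proj_opP H (M : clsubspace H) x (y : cls_type M) :
  '[proj_op M x, y] = '[x, cls_val y].
Proof. by rewrite proj_opE adjPr. Qed.

Lemma proj_opK H (M : clsubspace H) (x : cls_type M) : proj_op M (cls_val x) = x.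
Proof. by apply: hdot_inj => z; rewrite proj_opP. Qed.

Lemma cls_val_proj H (M : clsubspace H) x : cls_set M x -> cls_val (proj_op M x) = x.
Proof.
move=> /asboolP Mx; have -> : x = cls_val (ClsElt Mx) by [].
by rewrite proj_opK.
Qed.

(** The residue of [x] under the projection is orthogonal to [M], hence to [x] by hypothesis and to
    the projection of [x]; so it is orthogonal to itself. *)
Lemma orthocomplementK H (M : clsubspace H) x :
  (forall y, (forall z, cls_set M z -> '[y, z] = 0) -> '[x, y] = 0) -> cls_set M x.
Proof.
move=> h; have {}h : '[x, x - cls_val (proj_op M x)] = 0.
  by apply: h => z /asboolP Mz; rewrite hdotBl -(proj_opP x (ClsElt Mz)) subrr.
have h2 : '[cls_val (proj_op M x), x - cls_val (proj_op M x)] = 0.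
  by rewrite hdotC hdotBl -proj_opP subrr conjC0.
have /hdot_eq0/subr0_eq -> : '[x - cls_val (proj_op M x)] = 0.
  by rewrite hdotBl h h2 subrr.
exact: cls_valP.
Qed.

(** Trades the closure for orthogonality to the kernel of the adjoint; this is how later arguments
    handle defect spaces. *)
Lemma closed_rangeP H K (A : 'B(H, K)) x :
  cls_set (closed_range A) x <-> forall y, adj A y = 0 -> '[x, y] = 0.
Proof.
split=> [hx y Ay|h]; last first.
  apply: orthocomplementK => y hy; apply: h; apply: adj_eq0 => z.
  by apply: hy; apply/asboolP; exact: in_closed_range.
have /closure_id cl := @cls_closed _ _ (orthocomplement [set y]).
have : cls_set (orthocomplement [set y]) x.
  rewrite cl; apply: (closure_subset _ hx) => _ [z _ <-] /= _ ->.
  by rewrite adjP Ay hdot0r.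
by apply.
Qed.

Lemma corange_proj H K (A : 'B(H, K)) x :
  corange A x = proj_op (closed_range A) (A x).
Proof. by rewrite -[LHS]proj_opK. Qed.

(** * Strong limits, square roots and inverses *)

(** The increments telescope against those of [p], which is monotone and bounded, hence Cauchy. Both
    the square root iteration and the Neumann series are instances. *)
Lemma strong_limit H K (A : nat -> 'B(H, K)) (p : nat -> R[i]) (P : R[i]) :
  (forall n, p n <= p n.+1) -> (forall n, p n <= P) ->
  (forall n x, `|A n.+1 x - A n x| <= (p n.+1 - p n) * `|x|) ->
  exists B : 'B(H, K), forall x, A n x @[n --> \oo] --> B x.
Proof.
move=> p1 pP hA.
have pmono n k : p n <= p (n + k)%N.
  by elim: k => [|k IH]; rewrite ?addn0 // addnS (le_trans IH).
have Ank n k x : `|A (n + k)%N x - A n x| <= (p (n + k)%N - p n) * `|x|.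
  elim: k => [|k IH]; first by rewrite addn0 !subrr normr0 mul0r.
  have -> : A (n + k.+1)%N x - A n x =
      (A (n + k).+1 x - A (n + k)%N x) + (A (n + k)%N x - A n x).
    by rewrite addnS addrA subrK.
  rewrite (le_trans (ler_normD _ _)) // (le_trans (lerD (hA _ _) IH)) //.
  by rewrite -mulrDl addnS addrA subrK.
(* [- d] is the supremum of [p], obtained as an infimum of [- p]. *)
have [d [dp pd]] : exists d, (forall n, d <= - p n) /\ forall e, 0 < e -> exists n, - p n < d + e.
  by apply: (@inf_realC _ _ 0 _ (- P)) => n; rewrite lerN2.
have cvA x : exists y : K, A n x @[n --> \oo] --> y.
  suff : cauchy (A n x @[n --> \oo]) by move/cauchy_cvg => h; exists (lim (A n x @[n --> \oo])).
  apply/cauchyP => e e0.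
  have x1 : 0 < `|x| + 1 by rewrite ltr_wpDl.
  have [N hN] := pd _ (divr_gt0 e0 x1).
  exists (A N x); exists N => // n /= Nn; rewrite -ball_normE /= distrC -(subnKC Nn).
  have q0 : p (N + (n - N))%N - p N < e / (`|x| + 1).
    rewrite ltrBlDr; apply: (@le_lt_trans _ _ (- d)); first by rewrite lerNr.
    rewrite -subr_gt0; move: hN; rewrite -subr_gt0.
    by congr (0 < _); ring.
  apply: le_lt_trans (Ank _ _ _) _.
  apply: le_lt_trans (_ : _ <= (p (N + (n - N))%N - p N) * (`|x| + 1)) _.
    by rewrite ler_wpM2l ?subr_ge0 // lerDl.
  by rewrite -ltr_pdivlMr.
have [B hB] := choice cvA.
suff bB : is_bounded_op B by exists (Bop bB).
split.
  move=> a x y.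
  have l1 : A n (a *: x + y) @[n --> \oo] --> a *: B x + B y.
    rewrite (_ : (fun n => _) = (fun n => a *: A n x + A n y)).
      by apply: cvgD => //; apply: cvgZr.
    by apply/funext => n; rewrite linearP.
  exact: (hlim_unique (hB _) l1).
have [M [M0 hM]] := bop_bound (A 0).
exists (M + (P - p 0)) => [|x]; first by rewrite addr_ge0 ?subr_ge0.
have lim : (`|A n x| : R[i]^o) @[n --> \oo] --> (`|B x| : R[i]^o) by exact: cvg_norm (hB x).
apply: (cvg_leC lim); apply: nearW => n.
rewrite -[A n x](subrK (A 0 x)) (le_trans (ler_normD _ _)) // mulrDl addrC lerD //.
by rewrite -[n]add0n (le_trans (Ank _ _ _)) // ler_wpM2r // lerD2r.
Qed.

(** [positive_op] constrains only the quadratic form. Over complex scalars, polarisation with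
    [x + y] and [x + 'i *: y] recovers symmetry from the reality of its values. *)
Lemma positive_selfadj H (S : 'B(H, H)) : positive_op S -> adj S = S.
Proof.
move=> S0; apply: adj_unique => x y.
have sr z : '[S z, z] \is Num.real := ger0_real (S0 z).
have r1 : '[S x, y] + '[S y, x] \is Num.real.
  have -> : '[S x, y] + '[S y, x] = '[S (x + y), x + y] - '[S x, x] - '[S y, y].
    by rewrite bopD !hdotDl !hdotDr; ring.
  by rewrite !rpredB.
have r2 : 'i * ('[S y, x] - '[S x, y]) \is Num.real.
  have -> : 'i * ('[S y, x] - '[S x, y]) =
      '[S (x + 'i *: y), x + 'i *: y] - '[S x, x] - '[S y, y].
    rewrite bopD bopZ !hdotDl !hdotDr !hdotZl !hdotZr conjCi.
    have i2 : 'i * 'i = -1 :> R[i] by rewrite -expr2 sqrCi.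
    transitivity ('[S x, x] - 'i * 'i * '[S y, y] + 'i * ('[S y, x] - '[S x, y])
      - '[S x, x] - '[S y, y]); last by ring.
    by rewrite i2; ring.
  by rewrite !rpredB.
have e1 := CrealP r1; have e2 := CrealP r2.
rewrite rmorphD /= in e1; rewrite rmorphM /= conjCi rmorphB /= in e2.
have {}e2 : '[S x, y] - '[S y, x] = ('[S y, x])^* - ('[S x, y])^*.
  by apply: (mulfI (neq0Ci R[i])); rewrite -[LHS]opprK -mulrN opprB -e2 mulNr opprK.
rewrite [RHS]hdotC; apply: (mulfI (x := 2)); first by rewrite pnatr_eq0.
transitivity (('[S x, y] + '[S y, x]) + ('[S x, y] - '[S y, x])); first by ring.
by rewrite e2 -e1; ring.
Qed.

(* The iterates converge to [1 - (1 - B)^(1/2)]; [sqrt_bound] is the same iteration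
   for [B = 1], and its increments bound those of [sqrt_iter]. *)
Fixpoint sqrt_iter H (B : 'B(H, H)) (n : nat) : 'B(H, H) :=
  if n is m.+1 then 2^-1 *: (B + sqrt_iter B m \ob sqrt_iter B m) else 0.

Fixpoint sqrt_bound (n : nat) : R[i] :=
  if n is m.+1 then 2^-1 * (1 + sqrt_bound m ^+ 2) else 0.

Lemma sqrt_iterS H (B : 'B(H, H)) n x :
  sqrt_iter B n.+1 x = 2^-1 *: (B x + sqrt_iter B n (sqrt_iter B n x)).
Proof. by []. Qed.

(** Each iterate is a polynomial in [B], so it inherits every intertwining relation of [B]; passing
    to the limit, square roots will too. *)
Lemma sqrt_iter_comm H K (X : 'B(H, K)) B B' : X \ob B = B' \ob X ->
  forall n, X \ob sqrt_iter B n = sqrt_iter B' n \ob X.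
Proof.
move=> XB; have XBx x : X (B x) = B' (X x).
  by rewrite -[LHS]/((X \ob B) x) XB.
elim=> [|n IH]; apply: bop_eqP => x; first by rewrite bop_compE bop0.
have IHx y : X (sqrt_iter B n y) = sqrt_iter B' n (X y).
  by rewrite -[LHS]/((X \ob sqrt_iter B n) y) IH.
by rewrite !bop_compE !sqrt_iterS bopZ bopD XBx !IHx.
Qed.

Lemma sqrt_boundE n : sqrt_bound n.+1 = 2^-1 * (1 + sqrt_bound n ^+ 2).
Proof. by []. Qed.

Lemma sqrt_bound_ge0 n : 0 <= sqrt_bound n.
Proof. by elim: n => //= n IH; rewrite mulr_ge0 ?invr_ge0 ?addr_ge0 ?exprn_ge0. Qed.

Lemma sqrt_bound_le1 n : sqrt_bound n <= 1.
Proof.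
elim: n => //= n IH; rewrite ler_pdivrMl // mulr1 lerD2l.
by rewrite exprn_ile1 // sqrt_bound_ge0.
Qed.

Lemma sqrt_boundS n : sqrt_bound n <= sqrt_bound n.+1.
Proof.
elim: n => [|n IH]; first exact: sqrt_bound_ge0.
rewrite !sqrt_boundE ler_wpM2l ?invr_ge0 // lerD2l.
by rewrite -sqrt_boundE lerXn2r ?nnegrE ?sqrt_bound_ge0.
Qed.

Section SquareRoot.
Variables (H : hilbertType R) (B : 'B(H, H)).
Hypotheses (B_selfadj : adj B = B) (B_le1 : forall x, `|B x| <= `|x|).
Local Notation Y := (sqrt_iter B).

Lemma sqrt_iter_norm n x : `|Y n x| <= sqrt_bound n * `|x|.
Proof.
elim: n x => [|n IH] x; first by rewrite normr0 mul0r.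
rewrite sqrt_iterS normrZ ger0_norm ?invr_ge0 // sqrt_boundE.
rewrite -mulrA ler_wpM2l ?invr_ge0 // (le_trans (ler_normD _ _)) //.
rewrite mulrDl mul1r lerD //= (le_trans (IH _)) // expr2 -mulrA.
by rewrite ler_wpM2l ?sqrt_bound_ge0.
Qed.

Lemma sqrt_iterC m n x : Y m (Y n x) = Y n (Y m x).
Proof.
have BY : B \ob Y m = Y m \ob B by exact: sqrt_iter_comm.
by rewrite -[LHS]/((Y m \ob Y n) x) (sqrt_iter_comm (esym BY)).
Qed.

(** The iterates commute, so a difference of consecutive squares factors as
    [(Y n.+1 - Y n) (Y n.+1 + Y n)]; the scalar bounds satisfy the same recursion. *)
Lemma sqrt_iter_diff n x :
  `|Y n.+1 x - Y n x| <= (sqrt_bound n.+1 - sqrt_bound n) * `|x|.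
Proof.
elim: n x => [|n IH] x.
  rewrite sqrt_iterS sqrt_boundE.
  rewrite -[sqrt_iter B 0 x]/(0 : H) bop0 -[sqrt_bound 0]/(0 : R[i]) expr0n !subr0 !addr0 mulr1 normrZ.
  by rewrite ger0_norm ?invr_ge0 // ler_wpM2l ?invr_ge0.
have -> : Y n.+2 x - Y n.+1 x =
    2^-1 *: (Y n.+1 (Y n.+1 x + Y n x) - Y n (Y n.+1 x + Y n x)).
  rewrite (sqrt_iterS B n.+1) [X in _ - X]sqrt_iterS -scalerBr; congr (_ *: _).
  rewrite !bopD (sqrt_iterC n n.+1 x) opprD addrACA subrr add0r.
  by rewrite opprD addrA addrK.
have -> : sqrt_bound n.+2 - sqrt_bound n.+1 =
    2^-1 * ((sqrt_bound n.+1 - sqrt_bound n) * (sqrt_bound n.+1 + sqrt_bound n)).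
  by rewrite (sqrt_boundE n.+1) [X in _ - X]sqrt_boundE; ring.
rewrite normrZ ger0_norm ?invr_ge0 // -mulrA ler_wpM2l ?invr_ge0 //.
rewrite (le_trans (IH _)) // -mulrA ler_wpM2l ?subr_ge0 ?sqrt_boundS //.
by rewrite (le_trans (ler_normD _ _)) // mulrDl lerD ?sqrt_iter_norm.
Qed.

Lemma sqrt_iter_selfadj n x y : '[Y n x, y] = '[x, Y n y].
Proof.
elim: n x y => [|n IH] x y; first by rewrite hdot0l hdot0r.
rewrite !sqrt_iterS hdotZl hdotZr !hdotDl !hdotDr !IH.
by rewrite adjP B_selfadj fmorphV rmorph_nat.
Qed.

(** The limit [Z] solves [Z = (B + Z^2) / 2], that is [(1 - Z)^2 = 1 - B], and [1 - Z] is positive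
    because the iterates are contractions. The convergence clause is kept to transfer commutation
    relations to the root. *)
Lemma sqrt_exists : exists S : 'B(H, H), [/\ positive_op S, S \ob S = bid H - B
  & forall x, Y n x @[n --> \oo] --> x - S x].
Proof.
have [Z hZ] := strong_limit sqrt_boundS sqrt_bound_le1 sqrt_iter_diff.
have ZZ x : Y n (Y n x) @[n --> \oo] --> Z (Z x).
  apply/cvgrPdist_le => e e0.
  have /cvgrPdist_le/(_ _ (divr_gt0 e0 (ltr0Sn _ 1))) h1 := hZ x.
  have /cvgrPdist_le/(_ _ (divr_gt0 e0 (ltr0Sn _ 1))) h2 := hZ (Z x).
  apply: filterS (filterI h1 h2) => n [le1 le2].
  have -> : Z (Z x) - Y n (Y n x) = (Z (Z x) - Y n (Z x)) + Y n (Z x - Y n x).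
    by rewrite raddfB /= addrA subrK.
  rewrite (le_trans (ler_normD _ _)) // (splitr e) lerD //.
  rewrite (le_trans (sqrt_iter_norm _ _)) // (le_trans _ le1) //.
  by rewrite ler_piMl // sqrt_bound_le1.
have Zfix x : Z x = 2^-1 *: (B x + Z (Z x)).
  have l1 : Y n.+1 x @[n --> \oo] --> 2^-1 *: (B x + Z (Z x)).
    by apply: cvgZr; apply: cvgD (ZZ x); apply: cvg_cst.
  apply: (hlim_unique _ l1).
  apply: (cvg_comp S (fun n => Y n x) _ (hZ x)) => P [N _ hN].
  by exists N => // n /= Nn; apply: hN; exact: leqW.
exists (bid H - Z); split.
- move=> x; rewrite bop_subE hdotBl subr_ge0.
  apply: (cvg_leC (cvg_hdotl (z := x) _ (hZ x))); apply: nearW => n.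
  have sr : '[Y n x, x] \is Num.real.
    by apply/CrealP; rewrite -hdotC sqrt_iter_selfadj.
  rewrite (le_trans (real_ler_norm sr)) // (le_trans (hdot_norm_le _ _)) //.
  rewrite hdotxx expr2 ler_wpM2r // (le_trans (sqrt_iter_norm _ _)) //.
  by rewrite ler_piMl // sqrt_bound_le1.
- apply: bop_eqP => x; rewrite bop_compE !bop_subE bopB !bidE.
  have /(congr1 (fun t => 2 *: t)) := Zfix x.
  rewrite scalerA divff ?pnatr_eq0 // scale1r.
  rewrite scaler_nat mulr2n => h.
  by rewrite bopB opprB addrA addrAC -[x - Z x - Z x]addrA -opprD h opprD addrA subrK.
- by move=> x; rewrite bop_subE opprB addrC subrK.
Qed.

End SquareRoot.

(** The degenerate case of Cauchy-Schwarz for the semidefinite form ['[S x, y]]. *)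
Lemma positive_op_eq0 H (S : 'B(H, H)) y : positive_op S -> '[S y, y] = 0 -> S y = 0.
Proof.
move=> S0 Sy0; have Sa := positive_selfadj S0.
apply: hdot_inj => z; rewrite hdot0l.
have := variation0 (g := fun z => '[z, S y]) (q := fun z => '[S z, z]).
move=> /(_ _ _ _ _ z) => h; rewrite hdotC h ?conjC0 // => {z h}.
- by move=> a z; rewrite hdotZl.
- by move=> a z; rewrite bopZ hdotZl hdotZr mulrA -normCK.
move=> z; have := S0 (z + y); rewrite bopD !hdotDl !hdotDr Sy0 addr0.
by rewrite -hdotC -[in '[S z, y]]Sa adjPr addrA.
Qed.

(** For [y = (S - Q) x], commutation gives [(S + Q) y = 0], so both forms vanish at [y] and
    [S y = Q y = 0]; then ['[y]] equals ['[x, (S - Q) y]], which is zero. *)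
Lemma positive_root_unique H (S Q : 'B(H, H)) :
  positive_op S -> positive_op Q -> S \ob S = Q \ob Q -> S \ob Q = Q \ob S -> S = Q.
Proof.
move=> S0 Q0 SQ comm; apply: bop_eqP => x; apply: subr0_eq.
have SSx z : S (S z) = Q (Q z) by rewrite -[LHS]/((S \ob S) z) SQ.
have cx z : S (Q z) = Q (S z) by rewrite -[LHS]/((S \ob Q) z) comm.
set y := S x - Q x.
have SQy : S y + Q y = 0.
  by rewrite /y !bopB SSx cx addrA subrK subrr.
have h : '[S y, y] + '[Q y, y] = 0 by rewrite -hdotDl SQy hdot0l.
have/andP[/eqP Sy /eqP Qy] : ('[S y, y] == 0) && ('[Q y, y] == 0).
  by rewrite -paddr_eq0 ?h ?eqxx ?S0 ?Q0.
apply: hdot_eq0; rewrite {1}/y hdotBl -[in '[S x, _]](positive_selfadj S0).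
rewrite -[in '[Q x, _]](positive_selfadj Q0) !adjPr.
by rewrite (positive_op_eq0 S0 Sy) (positive_op_eq0 Q0 Qy) hdot0r subrr.
Qed.

Section SquareRootOperator.
Variables (H : hilbertType R) (B : 'B(H, H)).
Hypotheses (B_selfadj : adj B = B) (B_le1 : forall x, `|B x| <= `|x|).

(** The chosen root [Q] is arbitrary at first. Since [B = 1 - Q^2], it commutes with [B], hence with
    the iterates and their limit, and must be the root built by iteration. *)
Lemma sqrt_opP : [/\ positive_op (sqrt_op (bid H - B)),
  sqrt_op (bid H - B) \ob sqrt_op (bid H - B) = bid H - B
  & forall x, sqrt_iter B n x @[n --> \oo] --> x - sqrt_op (bid H - B) x].
Proof.
have [S [S0 SS SY]] := sqrt_exists B_selfadj B_le1.
rewrite /sqrt_op; case: xgetP => [Q _ /= [Q0 QQ]|/(_ S)/= []//].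
have commB : Q \ob B = B \ob Q.
  have BE : B = bid H - Q \ob Q by rewrite QQ opprB addrC subrK.
  by rewrite BE; apply: bop_eqP => x; rewrite !bop_compE !bop_subE bopB.
have SQ : S \ob Q = Q \ob S.
  apply: bop_eqP => x; rewrite !bop_compE.
  have l1 := SY (Q x).
  have l2 : sqrt_iter B n (Q x) @[n --> \oo] --> Q (x - S x).
    rewrite (_ : (fun n => _) = (fun n => Q (sqrt_iter B n x))).
      by apply: bop_cvg; exact: SY.
    by apply/funext => n; rewrite -bop_compE -(sqrt_iter_comm commB).
  have := hlim_unique l1 l2.
  by rewrite bopB => /addrI/oppr_inj.
by rewrite (positive_root_unique Q0 S0) ?QQ ?SS.
Qed.

End SquareRootOperator.

Lemma sqrt_op_intertwine H K (X : 'B(H, K)) B B' :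
  adj B = B -> (forall x, `|B x| <= `|x|) -> adj B' = B' -> (forall x, `|B' x| <= `|x|) ->
  X \ob B = B' \ob X ->
  X \ob sqrt_op (bid H - B) = sqrt_op (bid K - B') \ob X.
Proof.
move=> Ba B1 B'a B'1 XB; apply: bop_eqP => x; rewrite !bop_compE.
have [_ _ /(_ x) l] := sqrt_opP Ba B1; have [_ _ /(_ (X x)) l'] := sqrt_opP B'a B'1.
have l2 : sqrt_iter B' n (X x) @[n --> \oo] --> X (x - sqrt_op (bid H - B) x).
  rewrite (_ : (fun n => _) = (fun n => X (sqrt_iter B n x))); first exact: bop_cvg.
  by apply/funext => n; rewrite -[LHS]bop_compE -(sqrt_iter_comm XB).
have := hlim_unique l' l2.
by rewrite bopB => /addrI/oppr_inj ->.
Qed.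

Lemma neumann H (C : 'B(H, H)) (q : R[i]) : 0 <= q -> q < 1 ->
  (forall x, `|C x| <= q * `|x|) ->
  exists A : 'B(H, H), (bid H - C) \ob A = bid H /\ A \ob (bid H - C) = bid H.
Proof.
move=> q0 q1 hC.
(* [A n] and [p n] are the partial sums of the powers of [C] and of [q]. *)
pose A := fix A n : 'B(H, H) := if n is m.+1 then bid H + C \ob A m else 0.
pose p := fix p n : R[i] := if n is m.+1 then 1 + q * p m else 0.
have AS n x : A n.+1 x = x + C (A n x) by [].
have pS n : p n.+1 = 1 + q * p n by [].
(* The same partial sums, unfolded from the right: this gives the left inverse, and [AS] the right
   one. *)
have AS' n x : A n.+1 x = x + A n (C x).
  elim: n x => [|n IH] x; first by rewrite AS -[A 0%N x]/(0 : H) bop0.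
  by rewrite AS IH bopD -AS.
have p1 n : p n <= p n.+1.
  elim: n => [|n IH]; first by rewrite pS mulr0 addr0 ler01.
  by rewrite pS [leRHS]pS lerD2l ler_wpM2l.
have q10 : 0 < 1 - q by rewrite subr_gt0.
have pP n : p n <= (1 - q)^-1.
  elim: n => [|n IH]; first by rewrite invr_ge0 ltW.
  rewrite pS; apply: le_trans (_ : _ <= 1 + q * (1 - q)^-1) _.
    by rewrite lerD2l ler_wpM2l.
  by rewrite le_eqVlt; apply/orP; left; apply/eqP; field; rewrite gt_eqF.
have [Z hZ] : exists B : 'B(H, H), forall x, A n x @[n --> \oo] --> B x.
  apply: (strong_limit p1 pP); elim=> [|n IH] x.
    by rewrite AS -[A 0%N x]/(0 : H) bop0 pS -[p 0%N]/(0 : R[i]) mulr0 !addr0 !subr0 mul1r.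
  rewrite AS [X in _ - X]AS opprD addrACA subrr add0r -bopB (le_trans (hC _)) //.
  rewrite pS (pS n) opprD addrACA subrr add0r -mulrBr -mulrA.
  by rewrite ler_wpM2l.
have shift x : A n.+1 x @[n --> \oo] --> Z x.
  apply: (cvg_comp S (fun n => A n x) _ (hZ x)) => P [N _ hN].
  by exists N => // n /= Nn; apply: hN; exact: leqW.
exists Z; split; apply: bop_eqP => x; rewrite bop_compE bop_subE ?bopB !bidE.
  have l : A n.+1 x @[n --> \oo] --> x + C (Z x).
    by apply: cvgD; [exact: cvg_cst|exact: bop_cvg].
  by have {1}-> := hlim_unique (shift x) l; rewrite addrK.
have l : A n.+1 x @[n --> \oo] --> x + Z (C x).
  rewrite (_ : (fun n => _) = (fun n => x + A n (C x))).
    by apply: cvgD (hZ _); exact: cvg_cst.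
  by apply/funext => n; rewrite AS'.
by have -> := hlim_unique (shift x) l; rewrite addrK.
Qed.

(* Let [G] be the closed span of the pairs [(a i, b i)], and [P1], [P2] its coordinate
   maps. Equality of the Gram matrices says that [adj P1 P1] is half the identity, so
   [J = 2 P2 (adj P1)] needs no limit argument. *)
Lemma lurking_isometry (I : Type) H K (a : I -> H) (b : I -> K) :
  (forall i j, '[a i, a j] = '[b i, b j]) ->
  (forall x, (forall i, '[x, a i] = 0) -> x = 0) ->
  exists J : 'B(H, K), (forall i, J (a i) = b i) /\ adj J \ob J = bid H.
Proof.
move=> gram total.
pose HK : hilbertType R := hsum H K.
have hsumE (x y : HK) : '[x, y] = '[x.1, y.1] + '[x.2, y.2] by [].
pose S : set HK := [set ((a i, b i) : HK) | i in [set: I]].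
pose G := orthocomplement (orthocomplement_set S).
have GS g : S g -> cls_set G g.
  by move=> Sg; apply/orthocomplementP => f Gf; rewrite hdotC Gf // conjC0.
have G12 (g h : HK) : cls_set G g -> cls_set G h -> '[g.1, h.1] = '[g.2, h.2].
  (* Equal Gram matrices say that [S] is orthogonal to its image under the sign flip of the second
     coordinate. The relation extends to [G] in one argument, then in the other. *)
  move=> Gg Gh; pose h' : HK := (h.1, - h.2).
  suff : '[g, h'] = 0 by rewrite hsumE hdotNr => /subr0_eq.
  move/orthocomplementP: Gg; apply=> _ [i _ <-]; rewrite hsumE /= hdotNl.
  have : '[h, ((a i, - b i) : HK)] = 0.
    move/orthocomplementP: Gh; apply=> _ [j _ <-].
    by rewrite hsumE /= hdotNl gram subrr.
  by rewrite hsumE /= hdotNr.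
have b1 : is_bounded_op (fun g : cls_type G => (cls_val g).1).
  split=> //; exists 1 => // x; rewrite mul1r; apply: norm_le_hdot.
  by rewrite -[leRHS]/('[cls_val x]) hsumE lerDl hdot_ge0.
have b2 : is_bounded_op (fun g : cls_type G => (cls_val g).2).
  split=> //; exists 1 => // x; rewrite mul1r; apply: norm_le_hdot.
  by rewrite -[leRHS]/('[cls_val x]) hsumE lerDr hdot_ge0.
pose P1 : 'B(cls_type G, H) := Bop b1; pose P2 : 'B(cls_type G, K) := Bop b2.
have P12 g h : '[P1 g, P1 h] = '[P2 g, P2 h].
  by apply: G12; exact: cls_valP.
have GE (g h : cls_type G) : '[g, h] = 2 * '[P1 g, P1 h].
  by rewrite mulr_natl mulr2n {2}P12.
have P1P1 g : 2 *: adj P1 (P1 g) = g.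
  by apply: hdot_inj => h; rewrite hdotZl adjPr -GE.
(* The defect of this identity is orthogonal to the range of [P1], hence to each [a i]; here
   totality is used. *)
have P1onto x : P1 (2 *: adj P1 x) = x.
  apply/esym/subr0_eq/total => i.
  have Gi : cls_set G ((a i, b i) : HK) by apply: GS; exists i.
  have -> : a i = P1 (ClsElt (asboolT Gi)) by [].
  by rewrite -adjPr bopB bopZ (bopZ (adj P1)) P1P1 subrr hdot0l.
exists (P2 \ob (2 *: adj P1)); split=> [i|].
  have Gi : cls_set G ((a i, b i) : HK) by apply: GS; exists i.
  by rewrite bop_compE bop_scaleE -[a i]/(P1 (ClsElt (asboolT Gi))) P1P1.
apply: bop_eqP => x; apply: hdot_inj => z; rewrite bop_compE adjPr !bop_compE -P12.
by rewrite !bop_scaleE !P1onto.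
Qed.

End HilbertBasics.

(** * The space H^2 and its kernels *)

Section MultiIndices.
Variables (R : realType) (n : nat).
Implicit Types (k : mindex n) (i : 'I_n) (z w : 'I_n -> R[i]).

Definition mdeg k : nat := \sum_i k i.

Definition minc i k : mindex n := [ffun j => k j + (j == i)]%N.

Definition mdec i k : mindex n := [ffun j => k j - (j == i)]%N.

Definition mzero : mindex n := [ffun=> 0%N].

Lemma mincK i : cancel (minc i) (mdec i).
Proof. by move=> k; apply/ffunP => j; rewrite !ffunE addnK. Qed.

Lemma mdecK i k : (0 < k i)%N -> minc i (mdec i k) = k.
Proof.
by move=> ki; apply/ffunP => j; rewrite !ffunE; case: eqP => [->|_]; rewrite ?subnK // subn0 addn0.
Qed.

Lemma minc_gt0 i k : (0 < minc i k i)%N.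
Proof. by rewrite ffunE eqxx addn1. Qed.

Lemma mdec_inj i : {in [pred k : mindex n | (0 < k i)%N] &, injective (mdec i)}.
Proof. by move=> k l; rewrite !inE => ki li e; rewrite -(mdecK ki) e mdecK. Qed.

Lemma mdeg_inc i k : mdeg (minc i k) = (mdeg k).+1.
Proof.
rewrite /mdeg (bigD1 i) //= [in RHS](bigD1 i) //= ffunE eqxx addn1 addSn; congr (_ + _).+1.
by apply: eq_bigr => j /negbTE ji; rewrite ffunE ji addn0.
Qed.

Lemma mdeg_dec i k : (0 < k i)%N -> mdeg k = (mdeg (mdec i k)).+1.
Proof. by move=> ki; rewrite -(mdeg_inc i) mdecK. Qed.

Lemma mdeg_eq0 k : (mdeg k == 0)%N = (k == mzero).
Proof.
rewrite /mdeg sum_nat_eq0; apply/forallP/eqP => [h|-> i]; last by rewrite ffunE.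
by apply/ffunP => i; rewrite ffunE; apply/eqP; have := h i.
Qed.

Lemma leq_mdeg k i : (k i <= mdeg k)%N.
Proof. by rewrite /mdeg (bigD1 i) //= leq_addr. Qed.

Lemma gamma_neq0 k : gamma R k != 0.
Proof. by rewrite gt_eqF // gamma_gt0. Qed.

Lemma gamma_inc i k : gamma R (minc i k) * (k i).+1%:R = gamma R k * (mdeg k).+1%:R.
Proof.
have -> : gamma R (minc i k) =
    (mdeg k).+1%:R * (mdeg k)`!%:R / ((k i).+1 * \prod_j (k j)`!)%:R.
  rewrite /gamma -/(mdeg (minc i k)) mdeg_inc factS natrM; congr (_ / _%:R).
  rewrite (bigD1 i) //= [in RHS](bigD1 i) //= ffunE eqxx addn1 factS mulnA; congr (_ * _)%N.
  by apply: eq_bigr => j /negbTE ji; rewrite ffunE ji addn0.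
rewrite /gamma -/(mdeg k) natrM; field.
by rewrite nat1r !pnatr_eq0 -lt0n prodn_gt0 // => j; rewrite fact_gt0.
Qed.

Lemma gamma0 : gamma R mzero = 1.
Proof.
rewrite /gamma !big1 ?divff ?fact0 ?oner_eq0 // => i _; rewrite ?ffunE //.
Qed.

Lemma gamma_dec i k : (0 < k i)%N -> gamma R (mdec i k) * (mdeg k)%:R = gamma R k * (k i)%:R.
Proof.
move=> ki; have := gamma_inc i (mdec i k); rewrite mdecK // -(mdeg_dec ki) => <-.
by rewrite ffunE eqxx subn1 prednK.
Qed.

(** Pascal's rule for multinomial coefficients, or coefficientwise [1 / (1 - s) = 1 + s / (1 - s)]
    with [s] the sum of the variables. Multiplied by the degree, it reads [mdeg k = \sum_i k i]. *)
Lemma gamma_sum k : k != mzero -> gamma R k = \sum_(i | (0 < k i)%N) gamma R (mdec i k).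
Proof.
rewrite -mdeg_eq0 => k0.
have k0' : (mdeg k)%:R != 0 :> R[i] by rewrite pnatr_eq0.
apply: (mulIf k0'); rewrite mulr_suml.
under eq_bigr do rewrite gamma_dec //.
rewrite -mulr_sumr; congr (_ * _); rewrite /mdeg natr_sum.
rewrite (bigID (fun i => 0 < k i)%N) /= [X in _ + X]big1 ?addr0 // => i.
by rewrite -eqn0Ngt => /eqP ->.
Qed.

(** Since norms divide by [gamma], this makes the coordinate shifts contractive. *)
Lemma gamma_le_inc i k : gamma R k <= gamma R (minc i k).
Proof.
rewrite -(@ler_pM2r _ (k i).+1%:R) ?ltr0n // gamma_inc ler_wpM2l ?ler_nat ?ltnS ?leq_mdeg //.
exact/ltW/gamma_gt0.
Qed.

Definition monom z k : R[i] := \prod_i z i ^+ k i.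

Lemma monom_inc i z k : monom z (minc i k) = z i * monom z k.
Proof.
rewrite /monom (bigD1 i) //= [in RHS](bigD1 i) //= ffunE eqxx addn1 exprS mulrA; congr (_ * _).
by apply: eq_bigr => j /negbTE ji; rewrite ffunE ji addn0.
Qed.

Lemma monom_dec i z k : (0 < k i)%N -> monom z k = z i * monom z (mdec i k).
Proof. by move=> ki; rewrite -monom_inc mdecK. Qed.

Lemma monom0 z : monom z mzero = 1.
Proof. by rewrite /monom big1 // => i _; rewrite ffunE. Qed.

Lemma monom_ge0 z k : (forall i, 0 <= z i) -> 0 <= monom z k.
Proof. by move=> z0; apply: prodr_ge0 => i _; rewrite exprn_ge0. Qed.

Lemma norm_monom z k : `|monom z k| ^+ 2 = monom (fun i => `|z i| ^+ 2) k.
Proof.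
rewrite /monom normr_prod -prodrXl; apply: eq_bigr => i _.
by rewrite normrX exprAC.
Qed.

(* By [gamma_sum], the sum over degrees at most [m] is bounded by one plus
   [\sum_i r i] times the sum over degrees at most [m - 1]. *)
Lemma geometric_bound (r : 'I_n -> R[i]) (s : seq (mindex n)) :
  (forall i, 0 <= r i) -> \sum_i r i < 1 -> uniq s ->
  \sum_(k <- s) gamma R k * monom r k <= (1 - \sum_i r i)^-1.
Proof.
move=> r0 r1; set rho := \sum_i r i.
have rho1 : 0 < 1 - rho by rewrite subr_gt0.
have [m] : exists m, all (fun k => mdeg k < m)%N s.
  exists (\max_(k <- s) mdeg k).+1; apply/allP => k ks.
  by rewrite ltnS; apply: leq_bigmax_seq.
elim: m s => [|m IH] s sm us.
  by case: s sm us => // _ _; rewrite big_nil invr_ge0 ltW.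
pose g k := gamma R k * monom r k.
have g0 k : 0 <= g k by rewrite mulr_ge0 ?monom_ge0 ?ltW ?gamma_gt0.
have step k : k != mzero -> g k = \sum_(i | (0 < k i)%N) r i * g (mdec i k).
  move=> k0; rewrite /g gamma_sum // mulr_suml; apply: eq_bigr => i ki.
  by rewrite (monom_dec _ ki) mulrCA.
rewrite (bigID (pred1 mzero)) /= -/g.
have -> : (1 - rho)^-1 = 1 + \sum_i r i * (1 - rho)^-1.
  by rewrite -mulr_suml -/rho; field; rewrite gt_eqF.
apply: lerD.
  rewrite -big_filter (eq_big_seq (fun=> 1)); last first.
    by move=> k; rewrite mem_filter => /andP[/eqP -> _]; rewrite gamma0 monom0 mulr1.
  rewrite big_const_seq count_predT iter_addr_0 size_filter count_uniq_mem //.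
  by case: (_ \in _); rewrite ?ler01.
rewrite (eq_bigr (fun k => \sum_i (if (0 < k i)%N then r i * g (mdec i k) else 0))); last first.
  by move=> k k0; rewrite -big_mkcond -[LHS]/(g k) step.
apply: le_trans (_ : _ <= \sum_(k <- s) \sum_i (if (0 < k i)%N then r i * g (mdec i k) else 0)) _.
  rewrite [leRHS](bigID (pred1 mzero)) /= lerDr; apply: sumr_ge0 => k _.
  by apply: sumr_ge0 => i _; case: ifP => // _; rewrite mulr_ge0.
rewrite exchange_big /=; apply: ler_sum => i _.
rewrite -big_mkcond -mulr_sumr ler_wpM2l //.
rewrite -big_filter -(big_map (mdec i) predT g); apply: IH.
  apply/allP => _ /mapP[k + ->]; rewrite mem_filter => /andP[ki ks].
  by have := allP sm k ks; rewrite (mdeg_dec ki).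
rewrite map_inj_in_uniq ?filter_uniq // => k l.
rewrite !mem_filter => /andP[ki _] /andP[li _]; exact: mdec_inj.
Qed.

End MultiIndices.

Lemma base_expansion_inj (N m : nat) (a b : nat -> nat) :
  (forall i, i < m -> a i < N)%N -> (forall i, i < m -> b i < N)%N ->
  (\sum_(0 <= i < m) a i * N ^ i = \sum_(0 <= i < m) b i * N ^ i)%N ->
  forall i, (i < m)%N -> a i = b i.
Proof.
elim: m a b => // m IH a b aN bN.
have sumS (c : nat -> nat) : (\sum_(0 <= i < m.+1) c i * N ^ i =
    (\sum_(0 <= i < m) c i.+1 * N ^ i) * N + c 0)%N.
  rewrite big_nat_recl // expn0 muln1 addnC; congr (_ + _)%N.
  by rewrite big_distrl; apply: eq_bigr => i _; rewrite expnSr mulnA.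
rewrite !sumS => e; have N0 := leq_ltn_trans (leq0n _) (aN 0%N (ltn0Sn m)).
have e0 : a 0%N = b 0%N.
  by have := congr1 (modn^~ N) e; rewrite !modnMDl !modn_small ?aN ?bN.
have e1 : (\sum_(0 <= i < m) a i.+1 * N ^ i = \sum_(0 <= i < m) b i.+1 * N ^ i)%N.
  by apply/eqP; rewrite -(eqn_pmul2r N0); move/eqP: e; rewrite e0 eqn_add2r.
case=> // i im; apply: (IH (a \o succn) (b \o succn)) => // j jm; [exact: aN|exact: bN].
Qed.

(** * Monomials, kernels, evaluation and shifts *)

Section H2Theory.
Variables (R : realType) (n : nat).
Implicit Types (E F : hilbertType R) (k : mindex n) (i : 'I_n) (z w : 'I_n -> R[i]).

Lemma H2P E (f g : H2 n E) : (forall k, f k = g k) -> f = g.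
Proof. by move=> fg; apply/val_inj/funext. Qed.

Lemma H2_addE E (f g : H2 n E) k : (f + g) k = f k + g k.
Proof. by []. Qed.

Lemma H2_scaleE E a (f : H2 n E) k : (a *: f) k = a *: f k.
Proof. by []. Qed.

Lemma H2_sumE E (I : Type) (r : seq I) (f : I -> H2 n E) k :
  (\sum_(j <- r) f j) k = \sum_(j <- r) f j k.
Proof. by elim: r => [|j r IH]; rewrite ?big_nil // !big_cons H2_addE IH. Qed.

Lemma H2_dotE E (f g : H2 n E) : '[f, g] = sumdot (@gamma R n) f g.
Proof. by []. Qed.

Lemma cvg_H2_dot E (f g : H2 n E) :
  (partial_sum (fun k => '[f k, g k] / gamma R k) : {fset mindex n} -> R[i]^o) @ totally
    --> ('[f, g] : R[i]^o).
Proof. exact: (cvg_sumdot (@gamma_gt0 R n) (H2_sqsummable f) (H2_sqsummable g)). Qed.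

Lemma H2_bessel E (f : H2 n E) (s : seq (mindex n)) : uniq s ->
  \sum_(k <- s) `|f k| ^+ 2 / gamma R k <= '[f].
Proof.
move=> us; have := le_sumdot (@gamma_gt0 R n) [fset k in s]%fset (H2_sqsummable f).
rewrite partial_sumE; apply: le_trans; rewrite le_eqVlt; apply/orP; left; apply/eqP.
by apply: perm_big; apply: uniq_perm => [||k]; rewrite ?fset_uniq // inE.
Qed.

Lemma H2_norm_le E (f : H2 n E) M : 0 <= M ->
  (forall s, uniq s -> \sum_(k <- s) `|f k| ^+ 2 / gamma R k <= M ^+ 2) -> `|f| <= M.
Proof.
move=> M0 h; rewrite -(@ler_pXn2r _ 2) ?nnegrE // -hdotxx H2_dotE.
by apply: sumdot_le => [k|A]; [exact: gamma_gt0|rewrite partial_sumE h ?fset_uniq].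
Qed.

Lemma H2_predP E (a : mindex n -> E) M :
  (forall s, uniq s -> \sum_(k <- s) `|a k| ^+ 2 / gamma R k <= M) ->
  a \in @H2_pred R n E.
Proof. by move=> h; apply/asboolP; exists M => A; rewrite partial_sumE h ?fset_uniq. Qed.

Lemma delta_subproof E k (y : E) :
  (fun j => if j == k then y else 0) \in @H2_pred R n E.
Proof.
apply: (@H2_predP _ _ (`|y| ^+ 2 / gamma R k)) => s us.
rewrite (bigID (pred1 k)) /= [X in _ + X]big1 ?addr0; last first.
  by move=> j /negbTE ->; rewrite normr0 expr0n mul0r.
rewrite -big_filter (eq_big_seq (fun=> `|y| ^+ 2 / gamma R k)); last first.
  by move=> j; rewrite mem_filter => /andP[/eqP -> _]; rewrite eqxx.
rewrite big_const_seq count_predT iter_addr_0 size_filter count_uniq_mem //.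
by case: (_ \in _); rewrite ?mulr0n ?mulr1n // divr_ge0 ?exprn_ge0 // ltW ?gamma_gt0.
Qed.

(** The monomial [z^k y]. *)
Definition H2_delta E k (y : E) : H2 n E := MkH2 (delta_subproof k y).

Lemma H2_deltaE E k (y : E) j : H2_delta k y j = if j == k then y else 0.
Proof. by []. Qed.

Lemma H2_dot_delta E (f : H2 n E) k y : '[f, H2_delta k y] = '[f k, y] / gamma R k.
Proof.
apply: (cvg_unique (@norm_hausdorff _ R[i]^o) (@cvg_H2_dot E f (H2_delta k y))).
have : (fun=> '[f k, y] / gamma R k : R[i]^o) @ @totally (mindex n) -->
  ('[f k, y] / gamma R k : R[i]^o) by exact: cvg_cst.
apply: cvg_trans; apply: near_eq_cvg.
exists [fset k]%fset => // A; rewrite /mkset fsub1set => kA.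
rewrite partial_sumE (big_fsetD1 k) // H2_deltaE eqxx big1_seq => [|j]; first exact/esym/addr0.
by rewrite !inE H2_deltaE => /andP[_ /andP[/negbTE -> _]]; rewrite hdot0r mul0r.
Qed.

Definition H2_trunc E (f : H2 n E) (A : {fset mindex n}) : H2 n E :=
  \sum_(k <- A) H2_delta k (f k).

Lemma H2_truncE E (f : H2 n E) A k : H2_trunc f A k = if k \in A then f k else 0.
Proof.
rewrite H2_sumE; case: ifP => kA.
  rewrite (big_fsetD1 k) // H2_deltaE eqxx big1_seq => [|j]; first exact: addr0.
  by rewrite !inE H2_deltaE eq_sym => /andP[_ /andP[/negbTE -> _]].
rewrite big1_seq // => j /andP[_ jA]; rewrite H2_deltaE; case: eqP => // kj.
by rewrite kj jA in kA.
Qed.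

Lemma cvg_H2_trunc E (f : H2 n E) : H2_trunc f A @[A --> totally] --> f.
Proof.
apply/cvgrPdist_le => e e0.
have e2 : 0 < e ^+ 2 by rewrite exprn_gt0.
have /cvgrPdist_le/(_ _ e2) := @cvg_H2_dot E f f.
apply: filterS => A; rewrite partial_sumE => h.
rewrite -(@ler_pXn2r _ 2) ?nnegrE ?(ltW e0) // -hdotxx.
(* Pythagoras: the remainder vanishes on [A], so it is orthogonal to the truncation. *)
have -> : '[f - H2_trunc f A] = '[f, f] - \sum_(k <- A) '[f k, f k] / gamma R k.
  rewrite hdotBr [X in _ - X]hdot_sumr [X in _ - X]big1_seq ?subr0.
    rewrite hdotBl; congr (_ - _).
    rewrite hdotC hdot_sumr rmorph_sum; apply: eq_bigr => k _.
    rewrite H2_dot_delta; apply: (CrealP _).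
    by rewrite ger0_real // divr_ge0 ?hdot_ge0 ?ltW ?gamma_gt0.
  move=> k /andP[_ kA]; rewrite H2_dot_delta.
  have -> : (f - H2_trunc f A) k = f k - H2_trunc f A k by [].
  by rewrite H2_truncE kA subrr hdot0l mul0r.
apply: le_trans (real_ler_norm _) h; rewrite rpredB ?ger0_real ?hdot_ge0 //.
by apply: sumr_ge0 => k _; rewrite divr_ge0 ?hdot_ge0 ?ltW ?gamma_gt0.
Qed.

Lemma unit_ball0 : unit_ball (fun _ : 'I_n => 0 : R[i]).
Proof. by rewrite /unit_ball /= big1 // => i _; rewrite normr0 expr0n. Qed.

(** Taylor coefficients of [x / (1 - <., z>)], from the multinomial expansion of the geometric
    series. *)
Definition kernel_coef E z (x : E) : mindex n -> E := fun k => (gamma R k * (monom z k)^*) *: x.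

Lemma kernel_coef_bound E z (x : E) s : unit_ball z -> uniq s ->
  \sum_(k <- s) `|kernel_coef z x k| ^+ 2 / gamma R k <= (1 - \sum_i `|z i| ^+ 2)^-1 * `|x| ^+ 2.
Proof.
move=> zB us.
rewrite (eq_bigr (fun k => gamma R k * monom (fun i => `|z i| ^+ 2) k * `|x| ^+ 2)); last first.
  move=> k _; rewrite normrZ normrM norm_conjC (gtr0_norm (gamma_gt0 _ _)).
  rewrite [(_ * `|x|) ^+ 2]exprMn [(_ * `|monom z k|) ^+ 2]exprMn norm_monom.
  by field; exact: gamma_neq0.
rewrite -mulr_suml ler_wpM2r ?exprn_ge0 //.
by apply: geometric_bound => // i; rewrite exprn_ge0.
Qed.

Lemma kernel_exists E z : unit_ball z ->
  exists K : 'B(E, H2 n E), forall x k, K x k = (gamma R k * (monom z k)^*) *: x.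
Proof.
move=> zB.
have memK x : kernel_coef z x \in @H2_pred R n E.
  by apply: H2_predP => s us; exact: kernel_coef_bound.
suff bK : is_bounded_op (fun x => MkH2 (memK x)) by exists (Bop bK).
split.
  move=> a x y; apply: H2P => k; rewrite H2_addE H2_scaleE /= /kernel_coef.
  by rewrite scalerDr !scalerA mulrC.
have c0 : 0 <= (1 - \sum_i `|z i| ^+ 2)^-1 by rewrite invr_ge0 subr_ge0 ltW.
exists (sqrtC (1 - \sum_i `|z i| ^+ 2)^-1) => [|x]; first by rewrite sqrtC_ge0.
apply: H2_norm_le => [|s us]; first by rewrite mulr_ge0 ?sqrtC_ge0.
by rewrite exprMn sqrtCK kernel_coef_bound.
Qed.

(** Its adjoint is evaluation at [z], which makes evaluation a bounded operator; every use has [z]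
    in the ball, where the choice has a candidate. *)
Definition kernel E z : 'B(E, H2 n E) :=
  xget 0 [set K : 'B(E, H2 n E) | forall x k, K x k = (gamma R k * (monom z k)^*) *: x].

Lemma kernelE E z (x : E) k : unit_ball z ->
  kernel E z x k = (gamma R k * (monom z k)^*) *: x.
Proof.
by move=> /(kernel_exists E)[K hK]; rewrite /kernel; case: xgetP => [L _ -> //|/(_ K)/= []].
Qed.

Lemma adj_kernel_delta E z k (y : E) : unit_ball z ->
  adj (kernel E z) (H2_delta k y) = monom z k *: y.
Proof.
move=> zB; apply: hdot_injr => x; rewrite -adjP H2_dot_delta kernelE // hdotZl hdotZr.
by field; exact: gamma_neq0.
Qed.

Lemma cvg_eval E (f : H2 n E) z : unit_ball z ->
  (partial_sum (fun k => monom z k *: f k) : {fset mindex n} -> E) @ totally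
    --> adj (kernel E z) f.
Proof.
move=> zB.
have : adj (kernel E z) (H2_trunc f A) @[A --> totally] --> adj (kernel E z) f.
  by apply: bop_cvg; exact: cvg_H2_trunc.
apply: cvg_trans; rewrite (_ : (fun t => _) = partial_sum (fun k => monom z k *: f k)) //.
apply/funext => A; rewrite bop_sum /partial_sum -(big_seq_fsetE _ A predT (fun k => monom z k *: f k)).
by apply: eq_bigr => k _; rewrite adj_kernel_delta.
Qed.

Lemma H2_evalE E (f : H2 n E) z : unit_ball z -> H2_eval f z = adj (kernel E z) f.
Proof. by move=> zB; apply: (cvg_lim (@norm_hausdorff _ _)); exact: cvg_eval. Qed.


Definition shift_coef E i (f : mindex n -> E) : mindex n -> E :=
  fun k => if (0 < k i)%N then f (mdec i k) else 0.

Lemma shift_coef_bound E i (f : H2 n E) s : uniq s ->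
  \sum_(k <- s) `|shift_coef i f k| ^+ 2 / gamma R k <= '[f].
Proof.
move=> us; rewrite (bigID (fun k : mindex n => 0 < k i)%N) /= [X in _ + X]big1 ?addr0; last first.
  by move=> k /negbTE ki; rewrite /shift_coef ki normr0 expr0n mul0r.
apply: le_trans (_ : _ <= \sum_(k <- s | (0 < k i)%N) `|f (mdec i k)| ^+ 2 / gamma R (mdec i k)) _.
  apply: ler_sum => k ki; rewrite /shift_coef ki ler_wpM2l ?exprn_ge0 //.
  by rewrite lef_pV2 ?posrE ?gamma_gt0 // -{2}(mdecK ki) gamma_le_inc.
rewrite -big_filter -(big_map (mdec i) predT (fun k => `|f k| ^+ 2 / gamma R k)).
apply: H2_bessel; rewrite map_inj_in_uniq ?filter_uniq // => k l.
by rewrite !mem_filter => /andP[ki _] /andP[li _]; exact: mdec_inj.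
Qed.

Lemma shift_exists E i : exists S : 'B(H2 n E, H2 n E), forall f k, S f k = shift_coef i f k.
Proof.
have memS (f : H2 n E) : shift_coef i f \in @H2_pred R n E.
  by apply: (@H2_predP _ _ '[f]) => s us; exact: shift_coef_bound.
suff bS : is_bounded_op (fun f => MkH2 (memS f)) by exists (Bop bS).
split.
  move=> a f g; apply: H2P => k; rewrite H2_addE H2_scaleE /= /shift_coef.
  by case: ifP => _; rewrite ?H2_addE ?H2_scaleE // scaler0 addr0.
exists 1 => // f; apply: H2_norm_le => [|s us]; first by rewrite mul1r.
by rewrite mul1r -hdotxx shift_coef_bound.
Qed.

(** Multiplication by [z i] on Taylor coefficients. [Mz] is specified by values instead; [MzE]
    matches the two. *)
Definition zshift E i : 'B(H2 n E, H2 n E) :=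
  xget 0 [set S : 'B(H2 n E, H2 n E) | forall f k, S f k = shift_coef i f k].

Lemma shiftE E i (f : H2 n E) k : zshift E i f k = if (0 < k i)%N then f (mdec i k) else 0.
Proof.
by have [S hS] := shift_exists E i; rewrite /zshift; case: xgetP => [L _ -> //|/(_ S)/= []].
Qed.

Lemma shift_delta E i k (y : E) : zshift E i (H2_delta k y) = H2_delta (minc i k) y.
Proof.
apply: H2P => j; rewrite shiftE !H2_deltaE; case: ifP => ji.
  by rewrite -(inj_eq (can_inj (mincK i))) mdecK.
by case: eqP => // jk; rewrite jk minc_gt0 in ji.
Qed.

Lemma adj_shiftE E i (f : H2 n E) k :
  adj (zshift E i) f k = (gamma R k / gamma R (minc i k)) *: f (minc i k).
Proof.
apply: hdot_inj => y; apply: (mulIf (invr_neq0 (gamma_neq0 R k))).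
rewrite -H2_dot_delta adjPr shift_delta H2_dot_delta hdotZl.
by field; rewrite !gamma_neq0.
Qed.

Lemma adj_shift_kernel E i z (x : E) : unit_ball z ->
  adj (zshift E i) (kernel E z x) = (z i)^* *: kernel E z x.
Proof.
move=> zB; apply: H2P => k; rewrite adj_shiftE H2_scaleE !kernelE // !scalerA monom_inc rmorphM.
by congr (_ *: _); field; exact: gamma_neq0.
Qed.

Lemma eval_shift E i z (f : H2 n E) : unit_ball z ->
  adj (kernel E z) (zshift E i f) = z i *: adj (kernel E z) f.
Proof.
move=> zB; apply: hdot_injr => x; rewrite -adjP hdotZr -adjP.
by rewrite -adjPr adj_shift_kernel // hdotZl.
Qed.

(** The functional equation [K_w = 1 + <., w> K_w] of the geometric series; on coefficients it is
    [gamma_sum]. *)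
Lemma kernel_rec E w (x : E) : unit_ball w ->
  kernel E w x = H2_delta (mzero n) x + \sum_i (w i)^* *: zshift E i (kernel E w x).
Proof.
move=> wB; apply: H2P => k; rewrite H2_addE H2_sumE H2_deltaE.
have termE i : ((w i)^* *: zshift E i (kernel E w x)) k =
    (if (0 < k i)%N then gamma R (mdec i k) else 0) * (monom w k)^* *: x.
  rewrite H2_scaleE shiftE; case: ifP => ki; last by rewrite mul0r scale0r scaler0.
  by rewrite kernelE // scalerA (monom_dec _ ki) rmorphM mulrCA.
under eq_bigr do rewrite termE.
rewrite -scaler_suml -mulr_suml -big_mkcond /= kernelE //; case: eqP => [->|/eqP k0].
  rewrite big_pred0 => [|i]; last by rewrite ffunE.
  by rewrite mul0r scale0r addr0 gamma0 monom0 conjC1 mulr1 scale1r.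
by rewrite add0r -gamma_sum.
Qed.

Lemma eval_delta0 E z (x : E) : unit_ball z -> adj (kernel E z) (H2_delta (mzero n) x) = x.
Proof. by move=> zB; rewrite adj_kernel_delta // monom0 scale1r. Qed.

(** Evaluate [kernel_rec] at [z]. Leaving the factor on the left avoids division until it is shown
    to be nonzero. *)
Lemma kernel_gram E z w (x y : E) : unit_ball z -> unit_ball w ->
  (1 - \sum_i z i * (w i)^*) * '[kernel E w x, kernel E z y] = '[x, y].
Proof.
move=> zB wB; set K := '[_, _ _].
suff : K = '[x, y] + (\sum_i z i * (w i)^*) * K by rewrite mulrBl mul1r => {1}->; rewrite addrK.
rewrite {1}/K -adjPr {1}(kernel_rec x wB) bopD eval_delta0 // hdotDl; congr (_ + _).
rewrite bop_sum hdot_suml mulr_suml; apply: eq_bigr => i _.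
by rewrite bopZ eval_shift // !hdotZl adjPr mulrA [z i * _]mulrC.
Qed.

(* Let [m] be the least degree in [P]. The weight of [k] is dominated by its degree,
   and within degree [m] it reads [k] as an integer in base [m + 1]. *)
Lemma lowest_term (P : set (mindex n)) k0 : P k0 ->
  exists (a : 'I_n -> nat) (k : mindex n), [/\ forall i, (0 < a i)%N, P k &
    forall j, P j -> j != k -> (\sum_i a i * k i < \sum_i a i * j i)%N].
Proof.
move=> Pk0.
have [m [[k1 Pk1 dk1] mmin]] : exists m, (exists2 k, P k & mdeg k = m) /\
    forall k, P k -> (m <= mdeg k)%N.
  have ex : exists m, `[< exists2 k, P k & mdeg k = m >].
    by exists (mdeg k0); apply/asboolP; exists k0.
  exists (ex_minn ex); case: ex_minnP => m /asboolP mP mmin; split=> // k Pk.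
  by apply: mmin; apply/asboolP; exists k.
(* [L] bounds the base [m.+1] value of every index of degree at most [m], so with the factor [L.+1]
   one extra degree outweighs all the digits. *)
pose L := (m * m.+1 ^ n)%N.
pose a (i : 'I_n) := (L.+1 + m.+1 ^ i)%N.
pose W (k : mindex n) := (\sum_(i < n) k i * m.+1 ^ i)%N.
have wE k : (\sum_i a i * k i = L.+1 * mdeg k + W k)%N.
  rewrite /mdeg big_distrr -big_split; apply: eq_bigr => i _ /=.
  by rewrite mulnDl [(k i * _)%N]mulnC.
have Wle k : (mdeg k <= m)%N -> (W k <= L)%N.
  move=> km; apply: (@leq_trans (mdeg k * m.+1 ^ n)); last by rewrite leq_mul2r km orbT.
  rewrite /W /mdeg big_distrl; apply: leq_sum => i _ /=.
  by rewrite leq_mul2l leq_pexp2l ?orbT // ltnW.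
have [d [[k Pk dk] dmin]] : exists d, (exists2 k, P k & \sum_i a i * k i = d)%N /\
    forall k, P k -> (d <= \sum_i a i * k i)%N.
  have ex : exists d, `[< exists2 k : mindex n, P k & (\sum_i a i * k i = d)%N >].
    by exists (\sum_i a i * k0 i)%N; apply/asboolP; exists k0.
  exists (ex_minn ex); case: ex_minnP => d /asboolP dP dmin; split=> // k Pk.
  by apply: dmin; apply/asboolP; exists k.
have deg_d j : P j -> (\sum_i a i * j i = d)%N -> mdeg j = m.
  move=> Pj jd; apply/eqP; rewrite eqn_leq mmin // andbT leqNgt; apply/negP => mj.
  have := dmin _ Pk1; rewrite -jd !wE dk1 leqNgt; case/negP.
  apply: (@leq_ltn_trans (L.+1 * m + L)); first by rewrite leq_add2l Wle ?dk1.
  apply: (@leq_trans (L.+1 * m.+1)); first by rewrite mulnS addnC ltn_add2r.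
  by rewrite -[leqLHS]addn0 leq_add // leq_mul2l.
exists a, k; split=> // j Pj jk; rewrite dk ltn_neqAle dmin // andbT.
apply: contra jk => /eqP jd; apply/eqP/ffunP => i.
have jm := deg_d _ Pj (esym jd); have km := deg_d _ Pk dk.
have eW : W j = W k.
  by move: jd; rewrite -dk !wE jm km => /addnI.
(* Digits indexed by all naturals, padded with zeros beyond [n]. *)
pose ext (l : mindex n) (t : nat) := if insub t is Some i' then l i' else 0%N.
have extE (l : mindex n) (i' : 'I_n) : ext l i' = l i' by rewrite /ext valK.
have lt (l : mindex n) : mdeg l = m -> forall t, (t < n)%N -> (ext l t < m.+1)%N.
  by move=> lm t tn; rewrite -[t]/(nat_of_ord (Ordinal tn)) extE ltnS -lm leq_mdeg.
rewrite -!extE; apply: (base_expansion_inj (lt _ jm) (lt _ km)) => //.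
by rewrite !big_mkord; under eq_bigr do rewrite extE; under [RHS]eq_bigr do rewrite extE.
Qed.

Lemma partial_sum_seq (V : zmodType) (u : mindex n -> V) (A : {fset mindex n}) :
  partial_sum u A = \sum_(k <- A) u k.
Proof. by rewrite /partial_sum -(big_seq_fsetE _ A predT u). Qed.

(** Absolute convergence, uniform in [s]: split each term as [u v] with [sqrtC (gamma R k)] moved
    between the factors, and use [u v <= u^2 + v^2]. *)
Lemma eval_abs_bound E (f : H2 n E) z s : unit_ball z -> uniq s ->
  \sum_(k <- s) `|monom z k| * `|f k| <= '[f] + (1 - \sum_i `|z i| ^+ 2)^-1.
Proof.
move=> zB us.
apply: le_trans (_ : _ <= \sum_(k <- s) (`|f k| ^+ 2 / gamma R k + gamma R k * `|monom z k| ^+ 2)) _.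
  apply: ler_sum => k _.
  have g0 := gamma_gt0 R k; have gs : sqrtC (gamma R k) != 0 by rewrite gt_eqF ?sqrtC_gt0.
  set u := `|f k| / sqrtC (gamma R k); set v := sqrtC (gamma R k) * `|monom z k|.
  have -> : `|monom z k| * `|f k| = u * v by rewrite /u /v; field.
  have -> : `|f k| ^+ 2 / gamma R k = u ^+ 2 by rewrite /u exprMn exprVn sqrtCK.
  have -> : gamma R k * `|monom z k| ^+ 2 = v ^+ 2 by rewrite /v exprMn sqrtCK.
  have u0 : 0 <= u by rewrite divr_ge0 ?sqrtC_ge0 ?(ltW g0).
  have v0 : 0 <= v by rewrite mulr_ge0 ?sqrtC_ge0 ?(ltW g0).
  rewrite -subr_ge0 (_ : _ - _ = (u - v) ^+ 2 + u * v); last by ring.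
  by apply: addr_ge0; [rewrite real_exprn_even_ge0 // rpredB ?ger0_real|exact: mulr_ge0].
rewrite big_split lerD ?H2_bessel //=.
under eq_bigr do rewrite norm_monom.
by apply: geometric_bound => // i; rewrite exprn_ge0.
Qed.

(* On the curve [z i = (s t0) ^+ a i] with [a] given by [lowest_term], the term [k0]
   dominates the series as [s] tends to [0]. *)
Lemma H2_eval_inj E (f : H2 n E) :
  (forall z, unit_ball z -> adj (kernel E z) f = 0) -> f = 0.
Proof.
move=> f0; apply: contrapT => fn0.
have [k1 fk1] : exists k, f k <> 0.
  by apply: contrapT => h; apply: fn0; apply: H2P => k; apply: contrapT => fk; apply: h; exists k.
have [a [k0 [a0 fk0 kmin]]] := lowest_term (P := [set k | f k <> 0]) fk1.
pose wt (k : mindex n) := (\sum_i a i * k i)%N.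
(* On the curve each [|z i|^2] is at most [t0], so the sum is at most [n / (n + 1)] and the curve
   stays in the ball. *)
pose t0 : R[i] := n.+1%:R^-1.
have t00 : 0 < t0 by rewrite invr_gt0.
have t01 : t0 <= 1 by rewrite invf_le1 // ler1n.
pose z (s : R[i]) := fun i => (s * t0) ^+ a i.
have zE s k : monom (z s) k = s ^+ wt k * t0 ^+ wt k.
  rewrite /monom /z -exprMn /wt -prodrXr; apply: eq_bigr => i _; by rewrite -exprM.
have zB s : 0 < s -> s <= 1 -> unit_ball (z s).
  move=> s0 s1; rewrite /unit_ball /=.
  have st : 0 <= s * t0 by rewrite mulr_ge0 ?ltW.
  have st1 : s * t0 <= t0 by rewrite ler_piMl ?(ltW t00).
  apply: (@le_lt_trans _ _ (\sum_(i < n) t0)).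
    apply: ler_sum => i _; rewrite ger0_norm ?exprn_ge0 // -exprM.
    rewrite (le_trans _ st1) // -[leRHS]expr1 ler_wiXn2l ?muln_gt0 ?a0 //.
    exact: le_trans st1 t01.
  rewrite sumr_const card_ord -mulr_natl ltr_pdivrMr // mul1r ltr_nat //.
have z1B := zB _ ltr01 (lexx _).
pose C := '[f] + (1 - \sum_i `|z 1 i| ^+ 2)^-1.
have C0 : 0 <= C by rewrite addr_ge0 ?hdot_ge0 // invr_ge0 subr_ge0 ltW // z1B.
(* The series vanishes, so its [k0] term is no larger than the others together. These have weight at
   least [(wt k0).+1], which frees a factor [s], and what remains is bounded by [C] through the
   value at [s = 1]. *)
have key s : 0 < s -> s <= 1 -> t0 ^+ wt k0 * `|f k0| <= s * C.
  move=> s0 s1; rewrite -(ler_pM2l (exprn_gt0 (wt k0) s0)).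
  pose p A := partial_sum (fun k => monom (z s) k *: f k) A.
  have lim : p A @[A --> totally] --> (0 : E).
    by have := cvg_eval (f := f) (zB s s0 s1); rewrite f0 //; exact: zB.
  set q := s ^+ wt k0 * (t0 ^+ wt k0 * `|f k0|).
  have lim2 : (q - `|p A| : R[i]^o) @[A --> totally] --> (q : R[i]^o).
    by rewrite -[X in _ --> X]subr0 -(normr0 E); apply: cvgB; [exact: cvg_cst|exact: cvg_norm lim].
  apply: (cvg_leC lim2).
  exists [fset k0]%fset => // A; rewrite /mkset fsub1set => k0A.
  rewrite lerBlDl.
  have pE : p A = monom (z s) k0 *: f k0 + \sum_(k <- (A `\ k0)%fset) monom (z s) k *: f k.
    by rewrite /p partial_sum_seq (big_fsetD1 k0).
  have -> : q = `|p A - \sum_(k <- (A `\ k0)%fset) monom (z s) k *: f k|.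
    rewrite pE addrK normrZ zE ger0_norm ?mulr_ge0 ?exprn_ge0 ?(ltW s0) ?(ltW t00) //.
    by rewrite /q mulrA.
  rewrite (le_trans (ler_normB _ _)) // lerD2l (le_trans (ler_norm_sum _ _ _)) //.
  rewrite mulrA -exprSr.
  apply: le_trans (_ : _ <= s ^+ (wt k0).+1 * \sum_(k <- (A `\ k0)%fset) `|monom (z 1) k| * `|f k|) _.
    rewrite mulr_sumr big_seq [leRHS]big_seq; apply: ler_sum => k.
    rewrite !inE => /andP[kk0 _].
    have [-> |/eqP fk] := eqVneq (f k) 0; first by rewrite scaler0 normr0 !mulr0.
    have wk : ((wt k0).+1 <= wt k)%N by exact: kmin.
    rewrite normrZ mulrA ler_wpM2r // !zE expr1n mul1r.
    rewrite !ger0_norm ?mulr_ge0 ?exprn_ge0 ?(ltW s0) ?(ltW t00) //.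
    by rewrite ler_wpM2r ?exprn_ge0 ?(ltW t00) // ler_wiXn2l // ltW.
  by rewrite ler_wpM2l ?exprn_ge0 ?(ltW s0) // eval_abs_bound // fset_uniq.
have /eqP : t0 ^+ wt k0 * `|f k0| = 0.
  apply: (eq0_small_le _ C0) => [|s s0]; first by rewrite mulr_ge0 ?exprn_ge0 ?(ltW t00).
  have s1 : 0 < 1 + s by rewrite addr_gt0.
  (* [s / (1 + s)] is a parameter below both [1] and [s]. *)
  apply: le_trans (key (s / (1 + s)) _ _) _; first by rewrite divr_gt0.
    by rewrite ler_pdivrMr // mul1r lerDr.
  by rewrite ler_wpM2r // ler_pdivrMr // ler_peMr ?(ltW s0) // lerDl ltW.
by rewrite mulf_eq0 normr_eq0 expf_eq0 (gt_eqF t00) andbF => /eqP.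
Qed.

(** By [H2_eval_inj], at most one operator has prescribed values, so exhibiting one identifies the
    choice. *)
Lemma mul_op_unique E F (phi : ('I_n -> R[i]) -> E -> F) (M : 'B(H2 n E, H2 n F)) :
  (forall f z, unit_ball z ->
    adj (kernel F z) (M f) = phi z (adj (kernel E z) f)) ->
  mul_op phi = M.
Proof.
move=> hM; rewrite /mul_op; case: xgetP => [N _ /= hN|/(_ M)/= []]; last first.
  by move=> f z zB; rewrite !H2_evalE // hM.
apply: bop_eqP => f; apply/subr0_eq/H2_eval_inj => z zB.
by rewrite bopB hM // -!H2_evalE // hN // subrr.
Qed.

Lemma MzE E i : Mz E i = zshift E i.
Proof. by apply: mul_op_unique => f z zB; rewrite eval_shift. Qed.

End H2Theory.

(** * The characteristic function *)

Section OperatorBounds.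
Variable R : realType.
Implicit Types H K : hilbertType R.

Lemma norm_adj_le H K (A : 'B(H, K)) q : 0 <= q ->
  (forall x, `|A x| <= q * `|x|) -> forall y, `|adj A y| <= q * `|y|.
Proof.
move=> q0 hA y; have [->|Ay0] := eqVneq (adj A y) 0; first by rewrite normr0 mulr_ge0.
rewrite -(@ler_pM2l _ `|adj A y|) ?normr_gt0 // -expr2 -hdotxx.
have -> : '[adj A y] = `|'[y, A (adj A y)]| by rewrite -[in RHS]adjPr ger0_norm ?hdot_ge0.
rewrite (le_trans (hdot_norm_le _ _)) // mulrC mulrA ler_wpM2r //.
by rewrite [leRHS]mulrC.
Qed.

Lemma contraction_adj H K (A : 'B(H, K)) :
  (forall x, `|A x| <= `|x|) -> forall y, `|adj A y| <= `|y|.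
Proof.
move=> hA y; rewrite -[leRHS]mul1r; apply: norm_adj_le => // x.
by rewrite mul1r.
Qed.

Lemma adj_gram_selfadj H K (A : 'B(H, K)) : adj (adj A \ob A) = adj A \ob A.
Proof. by rewrite adj_comp adjK. Qed.

Lemma gram_contraction H K (A : 'B(H, K)) :
  (forall x, `|A x| <= `|x|) -> forall x, `|(adj A \ob A) x| <= `|x|.
Proof. by move=> hA x; rewrite bop_compE (le_trans (contraction_adj hA _)). Qed.

Lemma sqrt_op_gramP H K (A : 'B(H, K)) : (forall x, `|A x| <= `|x|) ->
  let D := sqrt_op (bid H - adj A \ob A) in
  adj D = D /\ forall x, D (D x) = x - adj A (A x).
Proof.
move=> hA D; have [D0 DD _] := sqrt_opP (adj_gram_selfadj A) (gram_contraction hA).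
by split=> [|x]; [exact: positive_selfadj|rewrite -bop_compE DD].
Qed.

(** [A] intertwines [A' A] with [A A'], hence also the square roots; for the row operator this is
    [T D_T = D_T' T]. *)
Lemma sqrt_op_gram_intertwine H K (A : 'B(H, K)) x : (forall x, `|A x| <= `|x|) ->
  A (sqrt_op (bid H - adj A \ob A) x) = sqrt_op (bid K - A \ob adj A) (A x).
Proof.
move=> hA; have hA' := contraction_adj hA.
have := @sqrt_op_intertwine _ _ _ A (adj A \ob A) (adj (adj A) \ob adj A).
move=> /(_ (adj_gram_selfadj _) (gram_contraction hA) (adj_gram_selfadj _) (gram_contraction hA')).
rewrite adjK => e; rewrite -[LHS]bop_compE e //.
by apply: bop_eqP.
Qed.

Lemma binvP H (A : 'B(H, H)) : (exists B, A \ob B = bid H /\ B \ob A = bid H) ->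
  A \ob binv A = bid H /\ binv A \ob A = bid H.
Proof. by move=> [B hB]; rewrite /binv; case: xgetP => [C _ /= //|/(_ B)/= []]. Qed.

End OperatorBounds.

Section RowOperators.
Variables (R : realType) (n : nat) (H : hilbertType R).
Implicit Types (T : 'I_n -> 'B(H, H)) (z w : 'I_n -> R[i]).

Lemma hpow_dotE (x y : hpow n H) : '[x, y] = \sum_i '[x i, y i].
Proof. by []. Qed.

Lemma rowopE T h : rowop T h = \sum_i T i (h i).
Proof. by []. Qed.

Lemma adj_rowopE T h i : adj (rowop T) h i = adj (T i) h.
Proof.
have -> : adj (rowop T) h = [ffun i => adj (T i) h] :> hpow n H; last by rewrite ffunE.
apply: hdot_inj => y; rewrite adjPr rowopE hdot_sumr hpow_dotE.
by apply: eq_bigr => j _; rewrite ffunE adjPr.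
Qed.

Definition scalar_row z : 'B(hpow n H, H) := rowop (fun i => z i *: bid H).

Lemma scalar_rowE z h : scalar_row z h = \sum_i z i *: h i.
Proof. by []. Qed.

Lemma adj_scalar_rowE z h i : adj (scalar_row z) h i = (z i)^* *: h.
Proof.
rewrite adj_rowopE; apply: hdot_inj => y.
by rewrite adjPr bop_scaleE bidE hdotZl hdotZr.
Qed.

Lemma adj_scalar_row_dot z w x y :
  '[adj (scalar_row w) x, adj (scalar_row z) y] = (\sum_i z i * (w i)^*) * '[x, y].
Proof.
rewrite hpow_dotE mulr_suml; apply: eq_bigr => i _.
by rewrite !adj_scalar_rowE hdotZl hdotZr conjCK mulrCA mulrA.
Qed.

Lemma scalar_row_norm z x : `|scalar_row z x| <= sqrtC (\sum_i `|z i| ^+ 2) * `|x|.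
Proof.
have s0 : 0 <= \sum_i `|z i| ^+ 2 by apply: sumr_ge0 => i _; rewrite exprn_ge0.
rewrite -(adjK (scalar_row z)); apply: norm_adj_le => [|y]; first by rewrite sqrtC_ge0.
rewrite -(@ler_pXn2r _ 2) ?nnegrE ?mulr_ge0 ?sqrtC_ge0 // exprMn -!hdotxx [sqrtC _ ^+ 2]sqrtCK.
rewrite adj_scalar_row_dot (eq_bigr (fun i => `|z i| ^+ 2)) // => i _.
by rewrite normCK.
Qed.

Lemma ball_dot_neq0 z w : unit_ball z -> unit_ball w -> 1 - \sum_i z i * (w i)^* != 0.
Proof.
move=> zB wB; rewrite subr_eq0; apply/eqP => e.
suff : `|\sum_i z i * (w i)^*| < 1 by rewrite -e normr1 ltxx.
apply: le_lt_trans (ler_norm_sum _ _ _) _.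
apply: (@le_lt_trans _ _ (2^-1 * (\sum_i `|z i| ^+ 2 + \sum_i `|w i| ^+ 2))).
  rewrite -big_split mulr_sumr; apply: ler_sum => i _ /=.
  rewrite normrM norm_conjC -subr_ge0.
  rewrite (_ : _ - _ = 2^-1 * (`|z i| - `|w i|) ^+ 2); last by field.
  by rewrite mulr_ge0 ?invr_ge0 // real_exprn_even_ge0 // rpredB ?normr_real.
by rewrite ltr_pdivrMl // mulr1 [ltRHS](_ : _ = 1 + 1) ?ltrD.
Qed.

End RowOperators.

(** * The characteristic function and the Poisson transform *)

Section CharacteristicFunctionTheory.
Variables (R : realType) (n : nat) (H : hilbertType R) (T : 'I_n -> 'B(H, H)).
Hypothesis hT : commuting_contractive T.
Implicit Types z w : 'I_n -> R[i].

Local Notation Tr := (rowop T).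
Local Notation Ts := (adj (rowop T)).
Local Notation D := (defect T).
Local Notation Ds := (defect_star T).
Local Notation DT := (defect_space T).
Local Notation DTs := (defect_star_space T).
Local Notation Z := (scalar_row H).

Lemma adj_row_contraction h : `|Ts h| <= `|h|.
Proof.
have [_ /(_ h)] := hT; rewrite bop_subE hdotBl subr_ge0 bidE => h0.
apply: norm_le_hdot; apply: le_trans h0; rewrite le_eqVlt; apply/orP; left; apply/eqP.
rewrite bop_sumE hdot_suml hpow_dotE; apply: eq_bigr => i _.
by rewrite !adj_rowopE bop_compE [RHS]adjP.
Qed.

Lemma row_contraction h : `|Tr h| <= `|h|.
Proof. by rewrite -(adjK Tr) (contraction_adj adj_row_contraction). Qed.

Lemma defectP : adj D = D /\ forall x, D (D x) = x - Ts (Tr x).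
Proof. exact: sqrt_op_gramP row_contraction. Qed.

Lemma defect_starP : adj Ds = Ds /\ forall x, Ds (Ds x) = x - Tr (Ts x).
Proof. by have := sqrt_op_gramP adj_row_contraction; rewrite adjK. Qed.

Lemma row_defect x : Tr (D x) = Ds (Tr x).
Proof. exact: sqrt_op_gram_intertwine row_contraction. Qed.

Lemma adj_row_defect x : Ts (Ds x) = D (Ts x).
Proof. by have := sqrt_op_gram_intertwine x adj_row_contraction; rewrite adjK. Qed.

Definition resolvent z := binv (bid H - Z z \ob Ts).

(** The norm of [Z z] is at most that of [z], and [Ts] is a contraction, so the Neumann series
    applies. *)
Lemma resolventP z : unit_ball z ->
  (forall x, resolvent z x - Z z (Ts (resolvent z x)) = x) /\
  (forall x, resolvent z (x - Z z (Ts x)) = x).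
Proof.
move=> zB.
have [|AR RA] := @binvP _ _ (bid H - Z z \ob Ts).
  apply: (@neumann _ _ _ (sqrtC (\sum_i `|z i| ^+ 2))).
  - by rewrite sqrtC_ge0; apply: sumr_ge0 => i _; rewrite exprn_ge0.
  - rewrite -(@ltr_pXn2r _ 2) ?nnegrE ?sqrtC_ge0 // ?expr1n ?sqrtCK //.
    by apply: sumr_ge0 => i _; rewrite exprn_ge0.
  - move=> x; rewrite bop_compE (le_trans (scalar_row_norm _ _)) // ler_wpM2l ?adj_row_contraction //.
    by rewrite sqrtC_ge0; apply: sumr_ge0 => i _; rewrite exprn_ge0.
split=> x.
  by rewrite -[RHS]/(bid H x) -AR.
by rewrite -[RHS]/(bid H x) -RA.
Qed.

Lemma adj_resolventP z x : unit_ball z ->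
  adj (resolvent z) x - Tr (adj (Z z) (adj (resolvent z) x)) = x.
Proof.
move=> /resolventP[_ RA]; apply: hdot_inj => y.
by rewrite hdotBl [X in _ - X]adjP [X in _ - X]adjPr -hdotBr adjPr RA.
Qed.

Lemma char_opE z x : char_op T z x = - Tr x + Ds (resolvent z (Z z (D x))).
Proof. by []. Qed.

Lemma adj_char_opE z x :
  adj (char_op T z) x = - Ts x + D (adj (Z z) (adj (resolvent z) (Ds x))).
Proof.
apply: hdot_injr => y; rewrite -adjP char_opE hdotDl hdotNl hdotDr hdotNr adjP.
by rewrite -{1}(proj1 defect_starP) -{2}(proj1 defectP) adjPr -!adjP.
Qed.

(** Write [a] and [b] for the resolvent vectors and [wa], [zb] for their images under the adjoint
    rows. The resolvent equation gives [Tr wa = a - Ds x], so the four products reduce to those of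
    [x], [y], [a], [b], except for ['[wa, zb]], which is [<z, w> '[a, b]]. *)
Lemma char_op_gram z w x y : unit_ball z -> unit_ball w ->
  '[adj (char_op T w) x, adj (char_op T z) y] + (1 - \sum_i z i * (w i)^*) *
    '[adj (resolvent w) (Ds x), adj (resolvent z) (Ds y)] = '[x, y].
Proof.
move=> zB wB; rewrite !adj_char_opE.
have ra := adj_resolventP (Ds x) wB; have rb := adj_resolventP (Ds y) zB.
set a := adj (resolvent w) _ in ra *; set b := adj (resolvent z) _ in rb *.
have wazb := adj_scalar_row_dot z w a b.
set wa := adj (Z w) a in ra wazb *; set zb := adj (Z z) b in rb wazb *.
have Twa : Tr wa = a - Ds x by rewrite -[X in _ - X]ra opprB addrC subrK.
have Tzb : Tr zb = b - Ds y by rewrite -[X in _ - X]rb opprB addrC subrK.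
have [Da DD] := defectP; have [Dsa DsDs] := defect_starP.
have Dsw u v : '[Ds u, v] = '[u, Ds v] by rewrite -{1}Dsa adjPr.
have Dw u v : '[D u, v] = '[u, D v] by rewrite -{1}Da adjPr.
have e1 : '[Ts x, Ts y] = '[x, y] - '[Ds x, Ds y].
  by rewrite adjPr Dsw DsDs -hdotBr opprB addrC subrK.
have e2 : '[Ts x, D zb] = '[Ds x, b - Ds y].
  by rewrite -Tzb -Dw -adj_row_defect adjPr.
have e3 : '[D wa, Ts y] = '[a - Ds x, Ds y].
  by rewrite -Twa [RHS]adjP adj_row_defect Dw.
have e4 : '[D wa, D zb] = '[wa, zb] - '[a - Ds x, b - Ds y].
  by rewrite Dw DD hdotBr -adjP Twa Tzb.
rewrite hdotDl !hdotDr !hdotNl !hdotNr opprK e1 e2 e3 e4 wazb.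
by rewrite !hdotBl !hdotBr; ring.
Qed.

(** Dually, if [Ds y = 0] then the adjoint sends [y] to [- Ts y], which [D] kills because
    [D Ts = Ts Ds]. *)
Lemma char_op_range z x : cls_set (closed_range D) x -> cls_set (closed_range Ds) (char_op T z x).
Proof.
move=> /closed_rangeP hx; apply/closed_rangeP => y.
rewrite (proj1 defect_starP) => Dy; rewrite adjP adj_char_opE Dy !bop0 addr0 hdotNr hx ?oppr0 //.
by rewrite (proj1 defectP) -adj_row_defect Dy bop0.
Qed.

Lemma adj_char_op_range z y :
  cls_set (closed_range Ds) y -> cls_set (closed_range D) (adj (char_op T z) y).
Proof.
move=> /closed_rangeP hy; apply/closed_rangeP => x.
rewrite (proj1 defectP) => Dx; rewrite adjPr char_opE Dx !bop0 addr0 hdotNr hy ?oppr0 //.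
by rewrite (proj1 defect_starP) -row_defect Dx bop0.
Qed.

Definition theta z : 'B(DT, DTs) :=
  proj_op (closed_range Ds) \ob char_op T z \ob bincl (closed_range D).

Lemma thetaE z x : cls_val (theta z x) = char_op T z (cls_val x).
Proof. by rewrite cls_val_proj //; apply: char_op_range; exact: cls_valP. Qed.

Lemma adj_thetaE z y : cls_val (adj (theta z) y) = adj (char_op T z) (cls_val y).
Proof.
have -> : adj (theta z) y = proj_op (closed_range D) (adj (char_op T z) (cls_val y)).
  by rewrite /theta !adj_comp !proj_opE adjK.
by rewrite cls_val_proj //; apply: adj_char_op_range; exact: cls_valP.
Qed.

Lemma char_funE z x : char_fun T z x = theta z x.
Proof. by rewrite /char_fun -thetaE; exact: (valKd (0 : DTs) (theta z x)). Qed.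

Definition poisson_value z : 'B(H, DTs) := proj_op (closed_range Ds) \ob Ds \ob resolvent z.

Lemma adj_poisson_valueE z y : adj (poisson_value z) y = adj (resolvent z) (Ds (cls_val y)).
Proof. by rewrite /poisson_value !adj_comp proj_opE adjK (proj1 defect_starP). Qed.

Lemma theta_gram z w (x y : DTs) : unit_ball z -> unit_ball w ->
  '[adj (theta w) x, adj (theta z) y] + (1 - \sum_i z i * (w i)^*) *
    '[adj (poisson_value w) x, adj (poisson_value z) y] = '[x, y].
Proof.
move=> zB wB; have := char_op_gram (cls_val x) (cls_val y) zB wB.
by rewrite -!adj_thetaE -!adj_poisson_valueE.
Qed.

Local Notation E := (H2 n DT).
Local Notation F := (H2 n DTs).

Lemma model_operators : exists (M : 'B(E, F)) (Pi : 'B(H, F)),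
  [/\ forall z f, unit_ball z -> adj (kernel DTs z) (M f) = theta z (adj (kernel DT z) f),
      forall z h, unit_ball z -> adj (kernel DTs z) (Pi h) = poisson_value z h
    & forall f g, '[adj M f, adj M g] + '[adj Pi f, adj Pi g] = '[f, g]].
Proof.
pose EH : hilbertType R := hsum E H.
have EHE (x y : EH) : '[x, y] = '[x.1, y.1] + '[x.2, y.2] by [].
pose I := ({z : 'I_n -> R[i] | unit_ball z} * DTs)%type.
pose a (i : I) : F := kernel DTs (sval i.1) i.2.
pose b (i : I) : EH :=
  (kernel DT (sval i.1) (adj (theta (sval i.1)) i.2), adj (poisson_value (sval i.1)) i.2).
have [||J [Ja JJ]] := @lurking_isometry _ I F EH a b.
- move=> [[w wB] x] [[z zB] y].
  change ('[kernel DTs w x, kernel DTs z y] =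
    '[kernel DT w (adj (theta w) x), kernel DT z (adj (theta z) y)] +
    '[adj (poisson_value w) x, adj (poisson_value z) y]).
  (* Both kernel products carry the factor [1 - <z, w>] in [kernel_gram]; after multiplying by it
     the goal is [theta_gram]. *)
  apply: (mulfI (ball_dot_neq0 zB wB)).
  by rewrite mulrDr !kernel_gram // theta_gram.
(* A vector orthogonal to all kernels has only zero values, so the kernels are total. *)
- move=> f hf; apply: H2_eval_inj => z zB; apply: hdot_inj => x.
  by rewrite adjPr hdot0l; exact: (hf (exist _ z zB, x)).
have b1 : is_bounded_op (fun g : EH => g.1).
  split=> //; exists 1 => // x; rewrite mul1r; apply: norm_le_hdot.
  by rewrite [leRHS]EHE lerDl hdot_ge0.
have b2 : is_bounded_op (fun g : EH => g.2).
  split=> //; exists 1 => // x; rewrite mul1r; apply: norm_le_hdot.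
  by rewrite [leRHS]EHE lerDr hdot_ge0.
pose J1 : 'B(F, E) := Bop b1 \ob J; pose J2 : 'B(F, H) := Bop b2 \ob J.
have J1K z x : unit_ball z -> J1 (kernel DTs z x) = kernel DT z (adj (theta z) x).
  by move=> zB; rewrite bop_compE -[kernel _ _ _]/(a (exist _ z zB, x)) Ja.
have J2K z x : unit_ball z -> J2 (kernel DTs z x) = adj (poisson_value z) x.
  by move=> zB; rewrite bop_compE -[kernel _ _ _]/(a (exist _ z zB, x)) Ja.
exists (adj J1), (adj J2); split.
- move=> z f zB; apply: hdot_inj => x.
  by rewrite adjPr adjPr J1K // [RHS]adjP [RHS]adjPr.
- by move=> z h zB; apply: hdot_inj => x; rewrite adjPr adjPr J2K // [RHS]adjP.
- by move=> f g; rewrite !adjK -[RHS](_ : '[J f, J g] = _) // -adjPr -bop_compE JJ.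
Qed.

(** This is [R_z = 1 + R_z Z T'] followed by [Ds]; read on Taylor coefficients it determines [Pi h]
    recursively. *)
Lemma poisson_value_rec z h : unit_ball z ->
  poisson_value z h = corange Ds h + \sum_i z i *: poisson_value z (adj (T i) h).
Proof.
move=> zB; have [_ RA] := resolventP zB.
have -> : \sum_i z i *: poisson_value z (adj (T i) h) = poisson_value z (Z z (Ts h)).
  rewrite scalar_rowE bop_sum; apply: eq_bigr => i _.
  by rewrite bopZ adj_rowopE.
by rewrite corange_proj -[in LHS](subrK (Z z (Ts h)) h) bopD !bop_compE RA.
Qed.


Lemma poisson_value0 h : poisson_value (fun=> 0) h = corange Ds h.
Proof.
rewrite poisson_value_rec; last exact: unit_ball0.
by rewrite big1 ?addr0 // => i _; rewrite scale0r.
Qed.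

(** * Intertwining relations and injectivity *)

Section ModelOperators.
Variables (M : 'B(E, F)) (Pi : 'B(H, F)).
Hypothesis evalM : forall z f, unit_ball z ->
  adj (kernel DTs z) (M f) = theta z (adj (kernel DT z) f).
Hypothesis evalPi : forall z h, unit_ball z ->
  adj (kernel DTs z) (Pi h) = poisson_value z h.

Lemma M_charE : M_char T = M.
Proof. by apply: mul_op_unique => f z zB; rewrite evalM // char_funE. Qed.

Lemma M_shift i f : M (zshift DT i f) = zshift DTs i (M f).
Proof.
apply/subr0_eq/H2_eval_inj => z zB.
by rewrite bopB evalM // !eval_shift // bopZ evalM // subrr.
Qed.

Lemma adj_M_shift i f : adj M (adj (zshift DTs i) f) = adj (zshift DT i) (adj M f).
Proof. by apply: hdot_inj => g; rewrite !adjPr M_shift. Qed.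

Lemma adj_T_comm i j h : adj (T i) (adj (T j) h) = adj (T j) (adj (T i) h).
Proof. by have [/(_ j i) c _] := hT; rewrite -!bop_compE -!adj_comp c. Qed.

Lemma Pi_rec h : Pi h = H2_delta (mzero n) (corange Ds h) +
  \sum_i zshift DTs i (Pi (adj (T i) h)).
Proof.
apply/subr0_eq/H2_eval_inj => z zB; rewrite bopB bopD eval_delta0 // bop_sum evalPi //.
under eq_bigr do rewrite eval_shift // evalPi //.
by rewrite -poisson_value_rec // subrr.
Qed.

Lemma Pi_coef_rec k h : k != mzero n ->
  Pi h k = \sum_(j | (0 < k j)%N) Pi (adj (T j) h) (mdec j k).
Proof.
move=> /negbTE k0; rewrite {1}Pi_rec H2_addE H2_deltaE k0 add0r H2_sumE.
by rewrite [RHS]big_mkcond; apply: eq_bigr => j _; rewrite shiftE.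
Qed.

(** Induction on the degree. Expanding the coefficient over [j], the induction hypothesis at
    [mdec j k] moves [T_i'] in and [T_j'] out, which requires them to commute; the weights then add
    up by [gamma_sum]. *)
Lemma Pi_coef i k h : (gamma R (minc i k))^-1 *: Pi h (minc i k) =
  (gamma R k)^-1 *: Pi (adj (T i) h) k.
Proof.
pose c k h := (gamma R k)^-1 *: Pi h k.
suff : forall m k h i, (mdeg k < m)%N -> c (minc i k) h = c k (adj (T i) h).
  by move=> /(_ (mdeg k).+1); apply.
elim=> // m IH {}k {}h {}i km.
have ki0 : minc i k != mzero n by rewrite -mdeg_eq0 mdeg_inc.
have term j : (0 < minc i k j)%N -> Pi (adj (T j) h) (mdec j (minc i k)) =
    gamma R (mdec j (minc i k)) *: c k (adj (T i) h).
  have PiE l u : Pi u l = gamma R l *: c l u.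
    by rewrite scalerA divff ?scale1r ?gamma_neq0.
  have [-> _|ji kj] := eqVneq j i; first by rewrite mincK -PiE.
  rewrite PiE; congr (_ *: _).
  have kj' : (0 < k j)%N by move: kj; rewrite ffunE (negbTE ji) addn0.
  have -> : mdec j (minc i k) = minc i (mdec j k).
    apply/ffunP => l; rewrite !ffunE; case: (eqVneq l j) => [->|_]; last by rewrite !subn0.
    by rewrite (negbTE ji) !addn0.
  have dk : (mdeg (mdec j k) < m)%N by rewrite -ltnS -mdeg_dec.
  by rewrite IH // adj_T_comm -IH // mdecK.
rewrite {1}/c Pi_coef_rec // (eq_bigr _ term) -scaler_suml -gamma_sum //.
by rewrite scalerA mulVf ?scale1r ?gamma_neq0.
Qed.

Lemma adj_shift_Pi i h : adj (zshift DTs i) (Pi h) = Pi (adj (T i) h).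
Proof.
apply: H2P => k; rewrite adj_shiftE -scalerA Pi_coef scalerA.
by rewrite divff ?scale1r ?gamma_neq0.
Qed.

Lemma Pi_injective : completely_noncoisometric T -> forall h, Pi h = 0 -> h = 0.
Proof.
move=> cnc h Ph; apply/eqP; apply: contraT => h0; case: cnc.
(* This is the kernel of [Pi], written so that it comes as a closed subspace. *)
pose N := orthocomplement (range (adj Pi)).
have NP g : cls_set N g <-> Pi g = 0.
  split=> [/orthocomplementP gN|Pg].
    by apply: hdot_inj => f; rewrite hdot0l -[Pi](adjK Pi) adjPr gN //; exists f.
  by apply/orthocomplementP => _ [f _ <-]; rewrite -adjP Pg hdot0l.
have Ninv i g : cls_set N g -> cls_set N (adj (T i) g).
  by move=> /NP Pg; apply/NP; rewrite -adj_shift_Pi Pg bop0.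
exists N; split=> //; first by exists h => //; apply/NP.
move=> g; have Ng := cls_valP g; have := NP (cls_val g); move=> [/(_ Ng) Pg _].
(* The value of [Pi g] at the origin is [Ds g]; its vanishing means [T T' g = g]. *)
have Dg : Ds (cls_val g) = 0.
  have := evalPi (cls_val g) (unit_ball0 R n); rewrite Pg bop0 poisson_value0.
  by move/(congr1 (@cls_val _ _ _)) => /= <-.
have compE i : cls_val (adj (compression N (T i)) g) = adj (T i) (cls_val g).
  have -> : adj (compression N (T i)) g = proj_op N (adj (T i) (cls_val g)).
    by rewrite /compression !adj_comp !proj_opE adjK.
  by rewrite cls_val_proj //; exact: Ninv.
apply: norm_eq_hdot; rewrite hpow_dotE.
transitivity ('[Ts (cls_val g), Ts (cls_val g)]).
  rewrite hpow_dotE; apply: eq_bigr => i _.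
  by rewrite !adj_rowopE -compE.
have [_ /(_ (cls_val g))] := defect_starP; rewrite Dg bop0 => e.
by rewrite adjPr -(subKr (cls_val g) (Tr _)) -e subr0.
Qed.

End ModelOperators.

End CharacteristicFunctionTheory.

(** * The model *)

Section ContractionModel.
Variables (R : realType) (E F H : hilbertType R).
Variables (M : 'B(E, F)) (Pi : 'B(H, F)) (Dl : 'B(E, E)).
Hypothesis Dl_selfadj : adj Dl = Dl.
Hypothesis Dl_sqr : forall x, Dl (Dl x) = x - adj M (M x).
Hypothesis MPi : forall f g, '[adj M f, adj M g] + '[adj Pi f, adj Pi g] = '[f, g].
Hypothesis Pi_inj : forall h, Pi h = 0 -> h = 0.

Local Notation Rg := (cls_type (closed_range Dl)).
Local Notation FR := (hsum F Rg).

(** [model_space] for abstract [M] and [Dl]: the model argument needs only the operator identities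
    assumed in this section. *)
Definition graph_complement : clsubspace FR :=
  orthocomplement [set ((M u, corange Dl u) : FR) | u in setT].

Local Notation G := graph_complement.

Lemma Dl_dot x y : '[Dl x, y] = '[x, Dl y].
Proof. by rewrite -{1}Dl_selfadj adjPr. Qed.

Lemma hsum_dotE (x y : FR) : '[x, y] = '[x.1, y.1] + '[x.2, y.2].
Proof. by []. Qed.

Lemma cls_dotE (v w : Rg) : '[v, w] = '[cls_val v, cls_val w].
Proof. by []. Qed.

Lemma dot_corange (v : Rg) u : '[v, corange Dl u] = '[Dl (cls_val v), u].
Proof. by rewrite Dl_dot. Qed.

Lemma graph_complementP (w : FR) :
  cls_set G w <-> adj M w.1 + Dl (cls_val w.2) = 0.
Proof.
have dotE u : '[w, ((M u, corange Dl u) : FR)] = '[adj M w.1 + Dl (cls_val w.2), u].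
  by rewrite hsum_dotE dot_corange hdotDl adjPr.
split=> [/orthocomplementP wG|wG].
  by apply: hdot_inj => u; rewrite hdot0l -dotE; apply: wG; exists u.
by apply/orthocomplementP => _ [u _ <-]; rewrite dotE wG hdot0l.
Qed.

Lemma Dl_injective (v : Rg) : Dl (cls_val v) = 0 -> v = 0.
Proof.
move=> v0; apply: hdot_eq0; have /closed_rangeP h := cls_valP v.
by rewrite cls_dotE h // Dl_selfadj.
Qed.

(** The closed range of a self-adjoint operator is orthogonal to its kernel, so [v] lies where the
    partial inverse is a true inverse. *)
Lemma Dl_pinvK (v : Rg) :
  'pinv_(fun=> 0) (cls_set (orthocomplement [set v | Dl v = 0])) Dl (Dl (cls_val v)) = cls_val v.
Proof.
have vP : cls_set (orthocomplement [set v | Dl v = 0]) (cls_val v).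
  apply/orthocomplementP => y y0; have /closed_rangeP h := cls_valP v.
  by rewrite h // Dl_selfadj.
apply: pinvKV; last exact: mem_set.
move=> x y /set_mem/orthocomplementP hx /set_mem/orthocomplementP hy xy.
apply/subr0_eq/hdot_eq0; rewrite {1}hdotBl.
have d0 : [set v | Dl v = 0] (x - y) by rewrite /mkset bopB xy subrr.
by rewrite hx // hy // subrr.
Qed.

Lemma model_coord_bounded : is_bounded_op (fun w : cls_type G => (cls_val w).1).
Proof.
split=> //; exists 1 => // x; rewrite mul1r; apply: norm_le_hdot.
by rewrite [leRHS](hsum_dotE (cls_val x)) lerDl hdot_ge0.
Qed.

Definition model_coord : 'B(cls_type G, F) := Bop model_coord_bounded.

Lemma model_coordE w : model_coord w = (cls_val w).1.
Proof. by []. Qed.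

Lemma model_coord_injective w : model_coord w = 0 -> w = 0.
Proof.
rewrite model_coordE => w0; have /graph_complementP := cls_valP w.
rewrite w0 bop0 add0r => /Dl_injective w20.
have w00 : cls_val w = (0, 0) by rewrite [LHS]surjective_pairing w0 w20.
exact: val_inj.
Qed.

Lemma model_coord_adj u : model_coord (adj model_coord u) = u - M (adj M u).
Proof.
(* The map [(M, Dl)] is an isometry, and [q] is [(u, 0)] minus its projection onto the graph, the
   image of [adj M u]. *)
pose q : FR := (u - M (adj M u), - corange Dl (adj M u)).
have qG : cls_set G q.
  apply/graph_complementP; rewrite -[q.1]/(u - M (adj M u)) -[cls_val q.2]/(- Dl (adj M u)).
  by rewrite bopB bopN Dl_sqr subrr.
suff -> : adj model_coord u = ClsElt (asboolT qG) by [].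
apply: hdot_inj => g; rewrite adjPr [RHS](hsum_dotE q (cls_val g)).
rewrite -[q.1]/(u - M (adj M u)) -[q.2]/(- corange Dl (adj M u)).
rewrite model_coordE hdotBl hdotNl [in '[corange _ _, _]]hdotC dot_corange -hdotC.
rewrite [in '[M _, _]]adjP -addrA -opprD -hdotDr.
by have /graph_complementP -> := cls_valP g; rewrite hdot0r subr0.
Qed.

Lemma model_unitary :
  exists2 U : 'B(cls_type G, H), unitary_op U & forall w, Pi (U w) = model_coord w.
Proof.
have [||J [Jb JJ]] := @lurking_isometry _ F (cls_type G) H (adj model_coord) (adj Pi).
- move=> u v; rewrite adjPr model_coord_adj hdotBr -(MPi u v).
  by rewrite -(adjPr M) addrAC subrr add0r.
- move=> w hw; apply: model_coord_injective; apply: hdot_inj => u.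
  by rewrite adjP hw hdot0l.
(* Injectivity of [Pi] makes the isometry onto: [J] sends [adj model_coord u] to [adj Pi u], so
   [J (adj J h) - h] is orthogonal to the range of [adj Pi]. *)
have JJ' : J \ob adj J = bid H.
  apply: bop_eqP => h; rewrite bop_compE bidE; apply/subr0_eq/Pi_inj.
  apply: hdot_inj => u; rewrite hdot0l adjP -Jb -adjPr bopB -(bop_compE (adj J)) JJ.
  by rewrite bidE subrr hdot0l.
exists J => // w; apply: hdot_inj => u.
by rewrite adjP -Jb -adjPr -bop_compE JJ -adjP.
Qed.

(** The first coordinate follows [Pi]. For the second, [Dl v = - M' u] holds before and after, and
    [M'] carries [SF] to [SE]. *)
Lemma model_intertwine (U : 'B(cls_type G, H)) (X : 'B(H, H)) (SE : 'B(E, E)) (SF : 'B(F, F)) w :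
  (forall w, Pi (U w) = model_coord w) -> (forall h, U (adj U h) = h) ->
  (forall f, adj M (SF f) = SE (adj M f)) -> (forall h, SF (Pi h) = Pi (X h)) ->
  let w' := cls_val (adj U (X (U w))) in
  w'.1 = SF (cls_val w).1 /\ Dl (cls_val w'.2) = SE (Dl (cls_val (cls_val w).2)).
Proof.
move=> PiU UU MS PiX w'.
have w'1 : w'.1 = SF (cls_val w).1.
  by rewrite -[LHS]/(model_coord (adj U (X (U w)))) -PiU UU -PiX PiU.
split=> //; have /graph_complementP/eqP := cls_valP (adj U (X (U w))).
rewrite addrC addr_eq0 => /eqP ->; rewrite -/w' w'1 MS.
have /graph_complementP/eqP := cls_valP w.
by rewrite addr_eq0 => /eqP ->; rewrite bopN opprK.
Qed.

Lemma contraction_model n (T : 'I_n -> 'B(H, H)) (SE : 'I_n -> 'B(E, E)) (SF : 'I_n -> 'B(F, F)) :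
  (forall i f, adj M (SF i f) = SE i (adj M f)) ->
  (forall i h, SF i (Pi h) = Pi (adj (T i) h)) ->
  exists TT : 'I_n -> 'B(cls_type G, cls_type G),
    (forall (i : 'I_n) (w : cls_type G),
      let u := (cls_val w).1 in
      let v := cls_val (cls_val w).2 in
      let w' := cls_val (adj (TT i) w) in
      [/\ range Dl (SE i (Dl v)), w'.1 = SF i u
        & cls_val w'.2 =
          'pinv_(fun=> 0) (cls_set (orthocomplement [set v | Dl v = 0])) Dl (SE i (Dl v))])
    /\ unitarily_equivalent T TT.
Proof.
move=> MS PiT; have [U UU PiU] := model_unitary.
have UU' h : U (adj U h) = h by rewrite -bop_compE (proj2 UU).
exists (fun i => adj U \ob T i \ob U); split=> [i w u v w'|]; last first.
  by exists U; split=> // i; apply: bop_eqP => h; rewrite !bop_compE !UU'.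
have [w'1 Dv] : w'.1 = SF i u /\ Dl (cls_val w'.2) = SE i (Dl v).
  have -> : w' = cls_val (adj U (adj (T i) (U w))) by rewrite /w' !adj_comp adjK.
  exact: model_intertwine.
(* The new second coordinate is itself the preimage under [Dl], so the inverse is applied inside the
   range. *)
by split=> //; [exists (cls_val w'.2)|rewrite -Dv Dl_pinvK].
Qed.

End ContractionModel.

Theorem theorem3p5 (R : realType) (n : nat) (H : hilbertType R)
    (T : 'I_n -> 'B(H, H))
    (hT : commuting_contractive T)
    (hcnc : completely_noncoisometric T) :
  exists TT : 'I_n -> 'B(cls_type (model_space T), cls_type (model_space T)),
    (forall (i : 'I_n) (w : cls_type (model_space T)),
      let u := (cls_val w).1 in
      let v := cls_val (cls_val w).2 in
      let w' := cls_val (adj (TT i) w) in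
      [/\ range (Delta T) (adj (Mz (defect_space T) i) (Delta T v)),
          w'.1 = adj (Mz (defect_star_space T) i) u
        & cls_val w'.2 = Delta_inv T (adj (Mz (defect_space T) i) (Delta T v))])
    /\ unitarily_equivalent T TT.
Proof.
have [M [Pi [evalM evalPi MPi]]] := model_operators hT.
have ME := M_charE hT evalM; rewrite -ME in evalM MPi.
(* The Gram identity bounds the adjoint of [M_char]; contractivity is what makes the square root
   [Delta] exist. *)
have M1 f : `|M_char T f| <= `|f|.
  rewrite -(adjK (M_char T)); apply: contraction_adj => {}f; apply: norm_le_hdot.
  by rewrite -[leRHS]MPi lerDl hdot_ge0.
have [Da DD] : adj (Delta T) = Delta T /\
    forall x, Delta T (Delta T x) = x - adj (M_char T) (M_char T x).
  exact: sqrt_op_gramP M1.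
apply: (contraction_model Da DD MPi (Pi_injective hT evalPi hcnc)
  (SE := fun i => adj (Mz (defect_space T) i)) (SF := fun i => adj (Mz (defect_star_space T) i))).
- by move=> i f; rewrite !MzE; exact: (adj_M_shift evalM).
- by move=> i h; rewrite MzE; exact: (adj_shift_Pi hT evalPi).
Qed.
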